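(* Let $G=\mathrm{SL}_2(\mathbb Z)$, let $B_X=\{\gamma\in G:\|\gamma\|\le X\}$, and let $\mu_X$ be the normalized counting measure on $B_X^2$. For $g=(g_1,g_2)$ let $\Gamma(g)=\langle g_1,g_1^{-1},g_2,g_2^{-1}\rangle$. Then $$\lim_{X\to\infty}\mu_X\big(\{g=(g_1,g_2)\in G^2 : \Gamma(g)\text{ is thin}\}\big)=1.$$
   Context: For $\gamma\in\mathrm{SL}_2(\mathbb R)$, $\|\gamma\|^2=\lambda_{\max}(\gamma^t\gamma)$ (largest eigenvalue). A subgroup $\Gamma\le \mathrm{GL}_n(\mathbb Z)$ with Zariski closure $\overline{\Gamma}$ in $\mathrm{GL}_n(\mathbb C)$ is thin if it has infinite index in $\overline{\Gamma}\cap\mathrm{GL}_n(\mathbb Z)$. *)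

(* Defs.v *)
From HB Require Import structures.
From mathcomp Require Import all_boot all_order all_algebra.
From mathcomp Require Import all_classical all_reals all_analysis.
From mathcomp Require Import finmap complex.
From mathcomp Require mpoly.

Set Implicit Arguments.
Unset Strict Implicit.
Unset Printing Implicit Defensive.

Import Order.TTheory GRing.Theory Num.Theory.
Import numFieldNormedType.Exports.
Local Open Scope classical_set_scope.
Local Open Scope ring_scope.

Notation M2Z := 'M[int]_2.

Definition SL2Z : set M2Z := [set g | \det g = 1].

Definition GL2Z : set M2Z := [set g | g \in unitmx].

Section Norms.
Variable R : realType.

Definition lambda_max (A : 'M[R]_2) : R := sup [set a : R | eigenvalue A a].

Definition opnorm (g : M2Z) : R :=
  let A := map_mx (fun z : int => z%:~R : R) g in
  Num.sqrt (lambda_max (A^T *m A)).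

Definition ball_SL2 (X : R) : set M2Z := [set g | SL2Z g /\ opnorm g <= X].

(* number of elements of a set (meaningful for finite sets; B_X^2 is finite) *)
Definition count_set (T : choiceType) (A : set T) : nat := #|` fset_set A |.

Definition mu_X (X : R) (S : set (M2Z * M2Z)) : R :=
  let B2 := ball_SL2 X `*` ball_SL2 X in
  (count_set (B2 `&` S))%:R / (count_set B2)%:R.

(* Zariski closure in GL_2(C) of a set S of integer matrices, intersected with
   GL_2(Z): the integer matrices h in GL_2(Z) such that every complex polynomial
   in the four matrix entries vanishing on S vanishes at h.  (Closed subsets of
   GL_2(C) are zero loci of polynomials in the entries and 1/det; multiplying
   by a power of det reduces to polynomials in the entries.) *)
Definition entries (g : M2Z) : 'I_4 -> complex R :=
  fun k => (g (inord (k %/ 2)%N) (inord (k %% 2)%N))%:~R.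

Definition zariski_closure_GL2Z (S : set M2Z) : set M2Z :=
  [set h | GL2Z h /\
     forall p : mpoly.mpoly 4 (complex R),
       (forall g, S g -> mpoly.meval (entries g) p = 0) ->
       mpoly.meval (entries h) p = 0].

Definition is_subgroup (H : set M2Z) : Prop :=
  H `<=` GL2Z /\ H 1%:M /\ (forall x y, H x -> H y -> H (x *m y)) /\
  (forall x, H x -> H (invmx x)).

Definition gen_subgroup (A : set M2Z) : set M2Z :=
  [set x | forall H, is_subgroup H -> A `<=` H -> H x].

Definition finite_index (Gamma H : set M2Z) : Prop :=
  exists s : seq M2Z, (forall x, x \in s -> H x) /\
    forall h, H h -> exists2 x, x \in s & Gamma (invmx x *m h).

Definition thin (Gamma : set M2Z) : Prop :=
  ~ finite_index Gamma (zariski_closure_GL2Z Gamma).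

Definition Gamma_of (g : M2Z * M2Z) : set M2Z :=
  gen_subgroup [set g.1; invmx g.1; g.2; invmx g.2].

Definition thin_pairs : set (M2Z * M2Z) :=
  [set g | SL2Z g.1 /\ SL2Z g.2 /\ thin (Gamma_of g)].
End Norms.

(* Main.v *)
Require Import Defs.
From HB Require Import structures.
From mathcomp Require Import all_boot all_order all_algebra.
From mathcomp Require Import all_classical all_reals all_analysis.
From mathcomp Require Import finmap complex zify ring lra.
From mathcomp Require mpoly.

(** Write [g] as [(a b; c d)].  Its isometric circle and that of its inverse are
    the intervals of radius [1 / |c|] about [- d / c] and [a / c].  If the four
    intervals of [g1], [g2] and their inverses are disjoint, then ping-pong shows
    that every nontrivial reduced word moves the point at infinity, so the group
    [Gamma] generated by [g1] and [g2] contains no nontrivial translation.  Yet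
    every large translation is in its Zariski closure: a polynomial vanishing on
    the words [g1^i g2 g1^n g2 g1^j] vanishes on [T g2 T g2 T], where [T] is the
    complex torus containing [g1], and in the eigenbasis of [g1] the latter set
    contains every matrix of determinant one without zero entries.  Hence [Gamma]
    has infinite index in its closure.

    It remains to see that the intervals of almost all pairs are disjoint.  Among
    the at least [c X^2] matrices of norm at most [X], few have small [|c|]; few have
    [|a + d| <= 2], because three roots modulo [c] of one quadratic polynomial
    cannot be within distance [|c|^(1/3)] of each other; and for a given interval
    with [|c'|] large, few have [a / c] close to it. *)

Set Implicit Arguments.
Unset Strict Implicit.
Unset Printing Implicit Defensive.

Import Order.TTheory GRing.Theory Num.Theory.
Import numFieldNormedType.Exports.
Local Open Scope classical_set_scope.
Local Open Scope ring_scope.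

(** * Two by two matrices *)

Definition mx22 (T : Type) (a b c d : T) : 'M[T]_2 :=
  \matrix_(i, j) if i == ord0 then (if j == ord0 then a else b)
                 else (if j == ord0 then c else d).

Section Matrices22.
Variable T : comPzRingType.
Implicit Types A B : 'M[T]_2.

Lemma mx22_00 (a b c d : T) : mx22 a b c d 0 0 = a. Proof. by rewrite mxE. Qed.
Lemma mx22_01 (a b c d : T) : mx22 a b c d 0 1 = b. Proof. by rewrite mxE. Qed.
Lemma mx22_10 (a b c d : T) : mx22 a b c d 1 0 = c. Proof. by rewrite mxE. Qed.
Lemma mx22_11 (a b c d : T) : mx22 a b c d 1 1 = d. Proof. by rewrite mxE. Qed.
Definition mx22E := (mx22_00, mx22_01, mx22_10, mx22_11).

Lemma ord2P (i : 'I_2) : i = 0 \/ i = 1.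
Proof. by case: i => [[|[|//]] i]; [left|right]; apply: val_inj. Qed.

Lemma eq_mx22 A B : A 0 0 = B 0 0 -> A 0 1 = B 0 1 -> A 1 0 = B 1 0 ->
  A 1 1 = B 1 1 -> A = B.
Proof.
move=> ? ? ? ?; apply/matrixP => i j.
by case: (ord2P i) => ->; case: (ord2P j) => ->.
Qed.

Lemma mx22_eta A : A = mx22 (A 0 0) (A 0 1) (A 1 0) (A 1 1).
Proof. by apply: eq_mx22; rewrite mx22E. Qed.

Lemma mulmx22 (a b c d a' b' c' d' : T) :
  mx22 a b c d *m mx22 a' b' c' d' =
  mx22 (a * a' + b * c') (a * b' + b * d') (c * a' + d * c') (c * b' + d * d').
Proof. by apply: eq_mx22; rewrite !mxE !big_ord_recl big_ord0 !mxE /= addr0. Qed.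

Lemma mulmx2E A B i j : (A *m B) i j = A i 0 * B 0 j + A i 1 * B 1 j.
Proof.
by rewrite mxE !big_ord_recl big_ord0 addr0; congr (_ + A i _ * B _ j); apply: val_inj.
Qed.

Lemma det_mx22 A : \det A = A 0 0 * A 1 1 - A 0 1 * A 1 0.
Proof.
rewrite (expand_det_row _ ord0) !big_ord_recl big_ord0 addr0 /cofactor !det_mx11 !mxE /=.
rewrite expr0 expr1 mul1r mulN1r mulrN; congr (_ * A _ _ - A _ _ * A _ _); exact: val_inj.
Qed.

Lemma scalar_mx22 (a : T) : a%:M = mx22 a 0 0 a.
Proof. by apply: eq_mx22; rewrite !mxE. Qed.
End Matrices22.

Definition adj22 (T : comPzRingType) (A : 'M[T]_2) : 'M[T]_2 :=
  mx22 (A 1 1) (- A 0 1) (- A 1 0) (A 0 0).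

Lemma adj22K (T : comPzRingType) : involutive (@adj22 T).
Proof. by move=> A; apply: eq_mx22; rewrite !mx22E ?opprK. Qed.

Lemma mulmx_adj22 (T : comPzRingType) (A : 'M[T]_2) : A *m adj22 A = (\det A)%:M.
Proof.
rewrite scalar_mx22 {1}(mx22_eta A) mulmx22 det_mx22.
by apply: eq_mx22; rewrite !mx22E; ring.
Qed.

Lemma det_adj22 (T : comPzRingType) (A : 'M[T]_2) : \det (adj22 A) = \det A.
Proof. by rewrite !det_mx22 !mx22E; ring. Qed.

Lemma invmx_adj22 (T : comUnitRingType) (A : 'M[T]_2) : \det A = 1 -> invmx A = adj22 A.
Proof.
move=> dA; have uA : A \in unitmx by rewrite unitmxE dA unitr1.
by rewrite -[RHS](mulKmx uA) mulmx_adj22 dA mulmx1.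
Qed.

(* The isometric circle of [g] is centred at [- d / c], so that of its inverse is
   centred at [a / c], both with radius [1 / |c|]: two such circles, with
   data [(a, c)] and [(a', c')], are disjoint when this holds. *)
Definition apart (a c a' c' : int) : bool := `|c| + `|c'| < `|a * c' - a' * c|.

(** * Ping-pong for reduced words in two matrices and their inverses *)

Section PingPong.
Variables g1 g2 : 'M[int]_2.

(** The first bit chooses the generator, the second the sign of its exponent; [adj22] is the inverse
    in determinant one. *)
Definition letter (s : bool * bool) : 'M[int]_2 :=
  let g := if s.1 then g1 else g2 in if s.2 then g else adj22 g.

Definition schottky : bool :=
  [forall s, forall t, (s != t) ==>
    apart (letter s 0 0) (letter s 1 0) (letter t 0 0) (letter t 1 0)].

Definition linv (s : bool * bool) := (s.1, ~~ s.2).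

Lemma linvK : involutive linv.
Proof. by case=> [[] []]. Qed.

Lemma letter_linv s : letter (linv s) = adj22 (letter s).
Proof. by case: s => [i []] //=; rewrite /letter /= adj22K. Qed.

Definition weval (w : seq (bool * bool)) : 'M[int]_2 :=
  foldr (fun s m => letter s *m m) 1%:M w.

Lemma weval_cat w w' : weval (w ++ w') = weval w *m weval w'.
Proof. by elim: w => [|s w IH] /=; rewrite ?mul1mx // IH mulmxA. Qed.

Fixpoint reduced (w : seq (bool * bool)) : bool :=
  if w is s :: w' then
    (if w' is t :: _ then t != linv s else true) && reduced w'
  else true.

Hypotheses (d1 : \det g1 = 1) (d2 : \det g2 = 1).

Lemma det_letter s : \det (letter s) = 1.
Proof. by case: s => [[] []]; rewrite /letter /= ?det_adj22. Qed.

Lemma letter_linvK s : letter s *m letter (linv s) = 1%:M.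
Proof. by rewrite letter_linv mulmx_adj22 det_letter. Qed.

Lemma det_weval w : \det (weval w) = 1.
Proof. by elim: w => [|s w IH] /=; rewrite ?det1 // det_mulmx det_letter mul1r. Qed.

Lemma weval_rev w : weval (rev (map linv w)) *m weval w = 1%:M.
Proof.
elim: w => [|s w IH] /=; first by rewrite mul1mx.
rewrite rev_cons -cats1 weval_cat /= mulmx1 -mulmxA (mulmxA (letter (linv s))).
by rewrite -{2}(linvK s) letter_linvK mul1mx.
Qed.

Lemma weval_reduced w : exists2 w', reduced w' & weval w = weval w'.
Proof.
elim: w => [|s w [w' rw ew]]; first by exists [::].
case: w' rw ew => [|t w'] rw ew; first by exists [:: s]; rewrite //= ew.
case: (eqVneq t (linv s)) => [ts|nts].
  exists w'; first by case/andP: rw.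
  by rewrite /= ew ts /= mulmxA letter_linvK mul1mx.
exists [:: s, t & w']; last by rewrite /= ew.
by rewrite /= in rw *; rewrite nts.
Qed.

Hypothesis sch : schottky.

(** The word maps infinity to within [1 / |c|] of [a / c], where [(a b; c d)] is its first letter
    [s]. Induction: the next letter is not [linv s], so its interval misses the isometric interval
    of [s], whose exterior [s] maps into the interval about [a / c]. *)
Lemma reduced_cone s w : reduced (s :: w) ->
  let v := weval (s :: w) in
  `|letter s 1 0 * v 0 0 - letter s 0 0 * v 1 0| < `|v 1 0|.
Proof.
elim: w s => [|t w IH] s.
  (* For a single letter the left side is zero, and [c] is nonzero because the intervals of a letter
     and of its inverse are disjoint. *)
  move=> _ /=; rewrite mulmx1.
  have /forallP/(_ s)/forallP/(_ (linv s)) := sch.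
  have -> : s != linv s by case: (s) => [[] []].
  rewrite /apart letter_linv !mx22E /= => h.
  by rewrite (mulrC (letter s 1 0)) subrr normr0 normr_gt0; apply/negP => /eqP c0; move: h;
    rewrite c0; lia.
move=> /= /andP [nts rw]; move: {IH}(IH t rw) => /=.
have /forallP/(_ (linv s))/forallP/(_ t)/implyP := sch.
rewrite eq_sym nts => /(_ isT); rewrite /apart letter_linv !mx22E.
move: (det_letter s); rewrite det_mx22.
set v := (letter t *m weval w).
rewrite !(mulmx2E (letter s)).
move: (letter s 0 0) (letter s 0 1) (letter s 1 0) (letter s 1 1) (letter t 0 0) (letter t 1 0).
move: (v 0 0) (v 1 0) => x y a b c d a' c' det1 far near.
(* By determinant one the claim is [|y| < |c x + d y|]: the point [x / y] is outside the isometric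
   interval of [s]. Otherwise the identity [e] would bring the centres [a' / c'] and [- d / c] too
   close for [far]. *)
have -> : c * (a * x + b * y) - a * (c * x + d * y) = - (a * d - b * c) * y by ring.
rewrite det1 mulN1r normrN ltNge; apply/negP => le.
have e : (d * c' - a' * - c) * y = c' * (c * x + d * y) - c * (c' * x - a' * y) by ring.
have : `|d * c' - a' * - c| * `|y| <= (`|- c| + `|c'|) * `|y|.
  rewrite -normrM e; apply: le_trans (ler_normB _ _) _.
  by rewrite !normrM normrN addrC mulrDl lerD // ler_wpM2l // ltW.
by apply/negP; rewrite -ltNge ltr_pM2r //; lia.
Qed.

(** A translation fixes infinity, whereas by [reduced_cone] a nonempty reduced word has a nonzero
    lower left entry. *)
Lemma weval_unipotent w (k : int) : weval w = mx22 1 k 0 1 -> k = 0.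
Proof.
have [w' rw ->] := weval_reduced w.
case: w' rw => [_|s w' rw] e.
  by move/matrixP: e => /(_ 0 1); rewrite mx22E mxE /= => <-.
by move: e (reduced_cone rw) => /= ->; rewrite !mx22E normr0 ltNge normr_ge0.
Qed.

End PingPong.

(** * Laurent polynomials and tori *)

Section Laurent.
Variable K : fieldType.

Definition laurent (F : K -> K) : Prop :=
  exists (p : {poly K}) (N : nat), forall x, x != 0 -> F x * x ^+ N = p.[x].

Lemma laurent_cst a : laurent (fun=> a).
Proof. by exists a%:P, 0 => x _; rewrite mulr1 hornerC. Qed.

Lemma laurent_id : laurent id.
Proof. by exists 'X, 0 => x _; rewrite mulr1 hornerX. Qed.

Lemma laurent_inv : laurent GRing.inv.
Proof. by exists 1, 1 => x x0; rewrite mulVf // hornerC. Qed.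

Lemma laurentM F G : laurent F -> laurent G -> laurent (fun x => F x * G x).
Proof.
move=> [p [M hp]] [q [N hq]]; exists (p * q), (M + N)%N => x x0.
by rewrite hornerM -hp // -hq // exprD; ring.
Qed.

Lemma laurentD F G : laurent F -> laurent G -> laurent (fun x => F x + G x).
Proof.
move=> [p [M hp]] [q [N hq]]; exists (p * 'X^N + q * 'X^M), (M + N)%N => x x0.
by rewrite hornerD !hornerM !hornerXn -hp // -hq // exprD; ring.
Qed.

Lemma laurentX F n : laurent F -> laurent (fun x => F x ^+ n).
Proof.
move=> hF; elim: n => [|n IH]; first exact: laurent_cst.
have [p [N hp]] := laurentM hF IH.
by exists p, N => x x0; rewrite exprS hp.
Qed.

Lemma laurent_sum (I : Type) (r : seq I) (F : I -> K -> K) :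
  (forall i, laurent (F i)) -> laurent (fun x => \sum_(i <- r) F i x).
Proof.
move=> hF; elim: r => [|i r IH].
  have [p [N hp]] := laurent_cst 0.
  by exists p, N => x x0; rewrite big_nil hp.
have [p [N hp]] := laurentD (hF i) IH.
by exists p, N => x x0; rewrite big_cons hp.
Qed.

Lemma laurent_prod (I : Type) (r : seq I) (F : I -> K -> K) :
  (forall i, laurent (F i)) -> laurent (fun x => \prod_(i <- r) F i x).
Proof.
move=> hF; elim: r => [|i r IH].
  have [p [N hp]] := laurent_cst 1.
  by exists p, N => x x0; rewrite big_nil hp.
have [p [N hp]] := laurentM (hF i) IH.
by exists p, N => x x0; rewrite big_cons hp.
Qed.

(** The numerator [p], if nonzero, would have [size p] distinct roots among the powers of [l], more
    than its degree allows. *)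
Lemma laurent_eq0 (F : K -> K) (l : K) : laurent F -> l != 0 ->
  injective (fun n => l ^+ n) -> (forall n, F (l ^+ n) = 0) ->
  forall x, x != 0 -> F x = 0.
Proof.
move=> [p [N hp]] l0 linj F0 x x0.
have p0 : p = 0.
  apply/eqP/negPn/negP => pn0.
  have := @max_poly_roots _ p [seq l ^+ n | n <- iota 0 (size p)] pn0.
  rewrite size_map size_iota ltnn map_inj_uniq // iota_uniq => H.
  suff : false by []. apply: H => //; rewrite all_map.
  by apply/allP => n _ /=; rewrite /root -hp ?expf_neq0 // F0 mul0r.
have := hp x x0; rewrite p0 horner0 => /eqP.
by rewrite mulf_eq0 (negPf (expf_neq0 _ x0)) orbF => /eqP.
Qed.

Definition mx_entries (A : 'M[K]_2) : 'I_4 -> K :=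
  fun k => A (inord (k %/ 2)) (inord (k %% 2)).

Lemma laurent_meval (p : mpoly.mpoly 4 K) (A B : 'M[K]_2) :
  laurent (fun x => mpoly.meval (mx_entries (x *: A + x^-1 *: B)) p).
Proof.
have /laurent_sum h : forall m, laurent (fun x => mpoly.mcoeff m p *
    \prod_i mx_entries (x *: A + x^-1 *: B) i ^+ mpoly.fun_of_multinom m i).
  move=> m; apply: laurentM; first exact: laurent_cst.
  apply: laurent_prod => i; apply: laurentX; rewrite /mx_entries.
  move: (inord _) (inord _) => l k.
  have [q [N hq]] := laurentD (laurentM laurent_id (laurent_cst (A k l)))
    (laurentM laurent_inv (laurent_cst (B k l))).
  by exists q, N => x x0; rewrite -(hq _ x0) !mxE.
have [q [N hq]] := h (mpoly.msupp p).
by exists q, N => x x0; rewrite mpoly.mevalE (hq _ x0).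
Qed.

End Laurent.

Definition nz_entries (T : nmodType) (m : 'M[T]_2) := forall i j, m i j != 0.

Section DiagonalTorus.
Variable K : fieldType.
Implicit Types A B : 'M[K]_2.

Definition diag22 (x : K) : 'M[K]_2 := mx22 x 0 0 x^-1.

Lemma diag22M x y : diag22 (x * y) = diag22 x *m diag22 y.
Proof.
by rewrite /diag22 mulmx22 invfM; apply: eq_mx22; rewrite !mx22E ?mulr0 ?mul0r ?addr0 ?add0r.
Qed.

Lemma diag22_exp x n : diag22 x ^+ n = diag22 (x ^+ n).
Proof.
elim: n => [|n IH]; last by rewrite !exprS diag22M -IH.
by apply: eq_mx22; rewrite !mx22E ?invr1 !mxE.
Qed.

(** This is a Laurent polynomial in [x] with matrix coefficients, the form that [laurent_meval]
    treats. *)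
Lemma diag22_split x A B :
  A *m diag22 x *m B =
  x *: (A *m mx22 1 0 0 0 *m B) + x^-1 *: (A *m mx22 0 0 0 1 *m B).
Proof.
have -> : diag22 x = x *: mx22 1 0 0 0 + x^-1 *: mx22 0 0 0 1.
  by apply: eq_mx22; rewrite !mxE /= ?mulr0 ?mulr1 ?addr0 ?add0r.
by rewrite mulmxDr mulmxDl -!scalemxAr -!scalemxAl.
Qed.

End DiagonalTorus.

Section Torus.
Variable K : numClosedFieldType.
Implicit Types m h W : 'M[K]_2.

Lemma quadratic_root (p q r : K) : p != 0 -> r != 0 ->
  exists2 y, y != 0 & p * y ^+ 2 + q * y + r = 0.
Proof.
move=> p0 r0; pose y := (- q + sqrtC (q ^+ 2 - 4 * p * r)) / (2 * p).
have hy : p * y ^+ 2 + q * y + r = 0.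
  transitivity ((sqrtC (q ^+ 2 - 4 * p * r) ^+ 2 - (q ^+ 2 - 4 * p * r)) / (4 * p)).
    by rewrite /y; field.
  by rewrite sqrtCK subrr mul0r.
exists y => //; apply/eqP => y0; move/eqP: hy.
by rewrite y0 expr0n /= !mulr0 !add0r (negPf r0).
Qed.

(** Write [(A B; C D)] for [m *m diag22 x *m m]. The outer factors preserve [A D] and [B C], so [x]
    is chosen to make [A D = a d]; then [B C = b c] follows from the determinants, and [x1], [x2]
    adjust the individual entries. *)
Lemma diag22_product m h : \det m = 1 -> \det h = 1 ->
  nz_entries m -> nz_entries h ->
  exists x1 x x2, [/\ x1 != 0, x != 0, x2 != 0 &
    diag22 x1 *m m *m diag22 x *m m *m diag22 x2 = h].
Proof.
rewrite !det_mx22 => dm dh mn hn.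
rewrite (mx22_eta m) (mx22_eta h).
move: dm dh (mn 0 0) (mn 0 1) (mn 1 0) (mn 1 1) (hn 0 0) (hn 0 1) (hn 1 0) (hn 1 1).
move: (m 0 0) (m 0 1) (m 1 0) (m 1 1) (h 0 0) (h 0 1) (h 1 0) (h 1 1) =>
  s t u v a b c d dm dh s0 t0 u0 v0 a0 b0 c0 d0.
(* This is [A D = a d] multiplied by [x ^ 2], as an equation in [y = x ^ 2]; its outer coefficients
   are nonzero because [m] has no zero entry. *)
have [||y y0 hy] := @quadratic_root (s ^+ 2 * t * u) (s ^+ 2 * v ^+ 2 + t ^+ 2 * u ^+ 2 - a * d)
  (t * u * v ^+ 2); rewrite ?mulf_neq0 ?expf_neq0 //.
pose x := sqrtC y; have x2 : x ^+ 2 = y by rewrite sqrtCK.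
have x0 : x != 0 by rewrite sqrtC_eq0.
pose A := s * x * s + t * x^-1 * u; pose B := s * x * t + t * x^-1 * v.
pose C := u * x * s + v * x^-1 * u; pose D := u * x * t + v * x^-1 * v.
have AD : A * D = a * d.
  by apply: (mulIf y0); rewrite -x2 -[RHS]addr0 -hy -x2 /A /D; field.
have BC : B * C = b * c.
  have : A * D - B * C = (s * v - t * u) ^+ 2 by rewrite /A /B /C /D; field.
  by rewrite dm expr1n AD -dh => /(addrI _) /oppr_inj.
have A0 : A != 0 by apply/eqP => A0; move/eqP: AD;
  rewrite A0 mul0r eq_sym mulf_eq0 (negPf a0) (negPf d0).
have B0 : B != 0 by apply/eqP => B0; move/eqP: BC;
  rewrite B0 mul0r eq_sym mulf_eq0 (negPf b0) (negPf c0).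
(* The entries [a] and [b] require [x1 x2 = a / A] and [x1 / x2 = b / B], whose product gives
   [x1 ^ 2]. *)
pose x1 := sqrtC (a / A * (b / B)).
have x1s : x1 ^+ 2 = a / A * (b / B) by rewrite sqrtCK.
have x10 : x1 != 0 by rewrite sqrtC_eq0 ?(mulf_neq0, invr_neq0).
exists x1, x, (a / (A * x1)); split=> //; first by rewrite ?(mulf_neq0, invr_neq0).
rewrite /diag22 !mulmx22 !mul0r !mulr0 !addr0 !add0r; apply: eq_mx22; rewrite !mx22E.
- have -> : x1 * s * x * s + x1 * t / x * u = x1 * A by rewrite /A; ring.
  by clearbody A; field; rewrite x10 A0.
- have -> : x1 * s * x * t + x1 * t / x * v = x1 * B by rewrite /B; ring.
  transitivity (x1 ^+ 2 * A / a * B); first by clearbody A B; field; rewrite a0 x10 A0.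
  by rewrite x1s; clearbody A B; field; rewrite A0 B0 a0.
- have -> : x1^-1 * u * x * s + x1^-1 * v / x * u = x1^-1 * C by rewrite /C; ring.
  transitivity (C * a / A / x1 ^+ 2); first by clearbody A C; field; rewrite x10 A0.
  rewrite x1s; transitivity (B * C / b); last by rewrite BC; field.
  by clearbody A B C; field; rewrite A0 B0 a0 b0.
- have -> : x1^-1 * u * x * t + x1^-1 * v / x * v = x1^-1 * D by rewrite /D; ring.
  transitivity (A * D / a); last by rewrite AD; field.
  by clearbody A D; field; rewrite a0 x10 A0.
Qed.

(** The three powers of [l] are freed one at a time: with the other factors fixed, the value of [p]
    is a Laurent polynomial in the remaining parameter that vanishes at all powers of [l]. The
    parameters are those of [diag22_product]. *)
Lemma meval_double_torus (p : mpoly.mpoly 4 K) (l : K) m W h :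
  l != 0 -> injective (fun n => l ^+ n) -> W \in unitmx ->
  \det m = 1 -> \det h = 1 -> nz_entries m -> nz_entries h ->
  (forall i n j, mpoly.meval (mx_entries
     (W *m (diag22 (l ^+ i) *m m *m diag22 (l ^+ n) *m m *m diag22 (l ^+ j)) *m invmx W)) p =
       0) ->
  mpoly.meval (mx_entries (W *m h *m invmx W)) p = 0.
Proof.
move=> l0 linj uW dm dh mn hn H.
have key A B : (forall n, mpoly.meval (mx_entries (A *m diag22 (l ^+ n) *m B)) p = 0) ->
    forall x, x != 0 -> mpoly.meval (mx_entries (A *m diag22 x *m B)) p = 0.
  move=> H0 x x0; rewrite diag22_split.
  apply: (laurent_eq0 (laurent_meval p _ _) l0 linj) x0 => n.
  by rewrite -diag22_split.
have [x1 [x [x2 [x10 x0 x20 <-]]]] := diag22_product dm dh mn hn.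
have := key (W *m (diag22 x1 *m m *m diag22 x *m m)) (invmx W) _ x2 x20; rewrite !mulmxA;
  apply => j.
have := key (W *m (diag22 x1 *m m)) (m *m diag22 (l ^+ j) *m invmx W) _ x x0;
  rewrite !mulmxA; apply => n.
have := key W (m *m diag22 (l ^+ n) *m m *m diag22 (l ^+ j) *m invmx W) _ x1 x10;
  rewrite !mulmxA; apply => i.
by have := H i n j; rewrite !mulmxA.
Qed.

End Torus.

(** * The eigenbasis of a Schottky pair *)

Section Eigenbasis.
Variable R : rcfType.

Lemma hyperbolic_eigenvalue (t : R) : 2 < `|t| ->
  exists l : R, 1 < `|l| /\ l + l^-1 = t.
Proof.
move=> t2; pose r := Num.sqrt (t ^+ 2 - 4).
have p : 0 < t ^+ 2 - 4.
  by rewrite subr_gt0 -real_normK ?num_real // (_ : 4 = 2 ^+ 2) ?ltr_pXn2r ?nnegrE // expr2;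
    lra.
have r0 : 0 < r by rewrite sqrtr_gt0.
have r2 : r ^+ 2 = t ^+ 2 - 4 by rewrite sqr_sqrtr // ltW.
have inv (l : R) : l ^+ 2 = t * l - 1 -> l + l^-1 = t.
  move=> e; have l0 : l != 0 by apply/eqP => l0; move: e; rewrite l0 expr0n /= mulr0; lra.
  by apply: (mulIf l0); rewrite mulrDl mulVf // -expr2 e; ring.
(* The square root is taken with the sign of [t], which selects the eigenvalue of larger absolute
   value. *)
have [tp|tn] := leP 0 t.
  rewrite ger0_norm // in t2; exists ((t + r) / 2); split; last by apply: inv; lra.
  by rewrite ger0_norm; lra.
rewrite ltr0_norm // in t2; exists ((t - r) / 2); split; last by apply: inv; lra.
by rewrite ltr0_norm; lra.
Qed.

(** For nonzero [c] the hypotheses put [x / z] outside the isometric interval of [(a b; c d)] and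
    [y / z] outside that of its inverse. If the matrix sent [x / z] to [y / z], two numbers larger
    than [|z|] in absolute value would have product [z ^ 2]. *)
Lemma mobius_neq (a b c d x y z : R) : a * d - b * c = 1 -> z != 0 ->
  `|z| < `|c * x + d * z| -> `|z| < `|a * z - c * y| ->
  z * (a * x + b * z) - y * (c * x + d * z) != 0.
Proof.
move=> det1 z0 far1 far2; apply/eqP => e.
have e2 : (c * x + d * z) * (a * z - c * y) = z ^+ 2.
  rewrite -[RHS]mulr1 -det1 -[RHS]addr0 -(mulr0 c) -e; ring.
have : `|z| * `|z| < `|c * x + d * z| * `|a * z - c * y| by apply: ltr_pM.
by rewrite -!normrM e2 expr2 ltxx.
Qed.

Lemma ltr_norm_perturb (e c m z : R) : `|m| < 1 -> `|z| + `|c| < `|e| ->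
  `|z| < `|e + c * m|.
Proof.
move=> m1 h; have : `|e| - `|c * m| <= `|e + c * m|
  by rewrite -[c * m]opprK normrN lerB_dist ?opprK.
have : `|c * m| <= `|c| by rewrite normrM ler_piMr // ltW.
lra.
Qed.

Lemma apart_intr (a c a' c' : int) : apart a c a' c' ->
  `|c%:~R| + `|c'%:~R| < `|a%:~R * c'%:~R - a'%:~R * c%:~R| :> R.
Proof. by rewrite -!intrM -intrB -!intr_norm -intrD ltr_int. Qed.

(** When [g] has determinant one and trace [l + l^-1], the columns are eigenvectors for [l] and
    [l^-1], scaled to share their lower entry. *)
Definition eigenmx (g : 'M[int]_2) (l : R) : 'M[R]_2 :=
  mx22 (l - (g 1 1)%:~R) (l^-1 - (g 1 1)%:~R) (g 1 0)%:~R (g 1 0)%:~R.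

Definition intmx (g : 'M[int]_2) : 'M[R]_2 := map_mx intr g.

Lemma nz_conj (W m : 'M[R]_2) : W \in unitmx ->
  nz_entries (adj22 W *m m *m W) -> nz_entries (invmx W *m m *m W).
Proof.
move=> uW nz i j; have -> : invmx W = (\det W)^-1 *: adj22 W.
  rewrite -[RHS](mulKmx uW) -scalemxAr mulmx_adj22 scale_scalar_mx mulVf ?mulmx1 //.
  by rewrite unitmxE unitfE in uW.
rewrite -!scalemxAl mxE mulf_neq0 ?invr_eq0 ?nz //.
by rewrite unitmxE unitfE in uW.
Qed.

Variables (g1 g2 : 'M[int]_2) (l : R).
Hypotheses (d1 : \det g1 = 1) (d2 : \det g2 = 1) (sch : schottky g1 g2).
Hypotheses (l1 : 1 < `|l|) (tr : l + l^-1 = (g1 0 0 + g1 1 1)%:~R).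
Let W := eigenmx g1 l.

Lemma schottky_apart s t : s != t ->
  apart (letter g1 g2 s 0 0) (letter g1 g2 s 1 0) (letter g1 g2 t 0 0) (letter g1 g2 t 1 0).
Proof. by move=> st; have /forallP/(_ s)/forallP/(_ t)/implyP := sch; apply. Qed.

Let l0 : l != 0. Proof. by rewrite -normr_gt0; exact: lt_trans ltr01 l1. Qed.
Let linv1 : `|l^-1| < 1. Proof. by rewrite normfV invf_lt1 // normr_gt0. Qed.

Let c1 : g1 1 0 != 0.
Proof.
have := @schottky_apart (true, true) (true, false) isT.
by rewrite /letter /= /apart !mx22E; apply: contraTN => /eqP ->; lia.
Qed.

Let c1R : (g1 1 0)%:~R != 0 :> R. Proof. by rewrite intr_eq0. Qed.

Let detR (g : 'M[int]_2) : \det g = 1 ->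
  (g 0 0)%:~R * (g 1 1)%:~R - (g 0 1)%:~R * (g 1 0)%:~R = 1 :> R.
Proof. by rewrite det_mx22 => e; rewrite -!intrM -intrB e. Qed.

Lemma eigenmx_unit : W \in unitmx.
Proof.
rewrite unitmxE unitfE det_mx22 !mx22E.
rewrite (_ : _ - _ = (g1 1 0)%:~R * (l - l^-1)); last by ring.
rewrite mulf_neq0 // subr_eq0; apply/eqP => e; move: linv1; by rewrite -e ltNge ltW.
Qed.

Lemma intmx_eigen : intmx g1 *m W = W *m diag22 l.
Proof.
have h := detR d1; have h2 : l * l^-1 = 1 by rewrite divff.
move: tr; rewrite intrD => tr'.
rewrite [intmx _]mx22_eta /W /eigenmx /diag22 !mulmx22 !mxE.
apply: eq_mx22; rewrite !mx22E; nra.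
Qed.

(** Up to sign, each entry is one of the expressions in the hypothesis: it vanishes when [g] maps
    the line of a column of [W] into the line of a column. *)
Lemma nz_adj22_conj (g : 'M[R]_2) :
  (forall x y, x \in [:: W 0 0; W 0 1] -> y \in [:: W 0 0; W 0 1] ->
    W 1 0 * (g 0 0 * x + g 0 1 * W 1 0) - y * (g 1 0 * x + g 1 1 * W 1 0) != 0) ->
  nz_entries (adj22 W *m g *m W).
Proof.
have -> : adj22 W = mx22 (W 1 0) (- W 0 1) (- W 1 0) (W 0 0).
  by apply: eq_mx22; rewrite !mx22E.
have e : W 1 1 = W 1 0 by rewrite !mx22E.
move=> h i j; clearbody W; rewrite (mx22_eta g) [X in _ *m X](mx22_eta W) !mulmx22 e.
move: h; move: (W 0 0) (W 0 1) (W 1 0) => x1 x2 z h.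
have := (h x1 x1, h x1 x2, h x2 x1, h x2 x2).
rewrite !inE !eqxx !orbT /= =>
  -[[[/(_ isT isT) h11 /(_ isT isT) h12] /(_ isT isT) h21] /(_ isT isT) h22].
by case: (ord2P i) => ->; case: (ord2P j) => ->; rewrite !mx22E;
  [move: h12 | move: h22 | rewrite -oppr_eq0; move: h11 | rewrite -oppr_eq0; move: h21];
  apply: contraNneq => e0; apply/eqP; rewrite -[RHS]e0; ring.
Qed.

(** The fixed points of [g1] lie in the intervals of [g1] and its inverse, hence outside those of
    [g2]; by [mobius_neq], [g2] maps no fixed point of [g1] to a fixed point of [g1]. *)
Lemma schottky_nz_conj : nz_entries (invmx W *m intmx g2 *m W).
Proof.
apply: nz_conj; first exact: eigenmx_unit.
apply: nz_adj22_conj => x y.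
have h13 := apart_intr (@schottky_apart (true, true) (false, false) isT).
have h23 := apart_intr (@schottky_apart (true, false) (false, false) isT).
have h14 := apart_intr (@schottky_apart (true, true) (false, true) isT).
have h24 := apart_intr (@schottky_apart (true, false) (false, true) isT).
move: tr h13 h23 h14 h24 (detR d2) linv1;
  rewrite /letter /= !mx22E !mxE !rmorphN /= intrD !normrN.
set m := l^-1.
move: c1R; move: (g1 0 0)%:~R (g1 1 0)%:~R (g1 1 1)%:~R => a1 z e1.
move: (g2 0 0)%:~R (g2 0 1)%:~R (g2 1 0)%:~R (g2 1 1)%:~R => a b c d.
move=> z0 tr' h13 h23 h14 h24 det m1 xw yw.
(* The fixed points are thus [(a1 - m) / z] and [(m - e1) / z], at distance [|m / z| < 1 / |z|] from
   the centres [a1 / z] and [- e1 / z]. *)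
have el : l - e1 = a1 - m by lra.
apply: mobius_neq => //.
- move: xw; rewrite el !inE => /orP[] /eqP ->.
    rewrite (_ : _ + _ = (c * a1 + d * z) + (- c) * m); last by ring.
    by apply: ltr_norm_perturb => //; rewrite normrN; apply: lt_le_trans h13 _;
      rewrite -normrN le_eqVlt; apply/orP; left; apply/eqP; congr `|_|; ring.
  rewrite (_ : _ + _ = (d * z - c * e1) + c * m); last by ring.
  by apply: ltr_norm_perturb => //; apply: lt_le_trans h23 _; rewrite le_eqVlt; apply/orP;
    left; apply/eqP; congr `|_|; ring.
- move: yw; rewrite el !inE => /orP[] /eqP ->.
    rewrite (_ : _ - _ = (a * z - c * a1) + c * m); last by ring.
    by apply: ltr_norm_perturb => //; apply: lt_le_trans h14 _; rewrite -normrN le_eqVlt;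
      apply/orP; left; apply/eqP; congr `|_|; ring.
  rewrite (_ : _ - _ = (a * z + c * e1) + (- c) * m); last by ring.
  by apply: ltr_norm_perturb => //; rewrite normrN; apply: lt_le_trans h24 _;
    rewrite le_eqVlt; apply/orP; left; apply/eqP; congr `|_|; ring.
Qed.

(** The translation shifts the fixed points of [g1] by [k], which exceeds their distance
    [|l - l^-1| / |c|]. *)
Lemma unipotent_nz_conj (k : int) : `|g1 0 0 + g1 1 1| + 2 <= k ->
  nz_entries (invmx W *m intmx (mx22 1 k 0 1) *m W).
Proof.
move=> hk; apply: nz_conj; first exact: eigenmx_unit.
apply: nz_adj22_conj => x y.
have : `|(g1 0 0 + g1 1 1)%:~R| + 2 <= k%:~R :> R.
  by rewrite -intr_norm -[2]/(2%:~R) -intrD ler_int.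
rewrite -tr !mxE /= ?mulr0z ?mulr1z !(mul0r, mul1r, add0r) => hkR.
have zz : 1 <= `|(g1 1 0)%:~R| :> R by rewrite -intr_norm ler1z; move: c1; lia.
have hk2 : `|l + l^-1| + 2 <= `|k%:~R * (g1 1 0)%:~R|.
  rewrite normrM; have kk := ler_norm (k%:~R : R).
  have p : 0 <= `|l + l^-1| by [].
  by apply: le_trans hkR _; apply: le_trans kk _; rewrite ler_peMr.
move: c1R hk2; move: (g1 1 0)%:~R (g1 1 1)%:~R (k%:~R) => z e1 kr z0 hk2 xw yw.
have ln : `|l - l^-1| < `|kr * z|.
  apply: lt_le_trans hk2.
  rewrite (_ : l - l^-1 = (l + l^-1) - 2 * l^-1); last by ring.
  apply: le_lt_trans (ler_normB _ _) _; rewrite normrM ltrD2l normr_nat.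
  by move: linv1; lra.
rewrite (_ : _ - _ = z * (kr * z - (y - x))); last by ring.
rewrite mulf_neq0 // subr_eq0; apply: contraTneq ln => ->; rewrite -leNgt.
move: xw yw; rewrite !inE => /orP[] /eqP -> /orP[] /eqP ->.
- by rewrite subrr normr0.
- by rewrite (_ : _ - _ - (_ - _) = - (l - l^-1)); [rewrite normrN | ring].
- by rewrite (_ : _ - _ - (_ - _) = l - l^-1); [ | ring].
- by rewrite subrr normr0.
Qed.

End Eigenbasis.

(** * Thinness *)

Section Thinness.
Variable R : realType.
Variables g1 g2 : M2Z.
Hypotheses (d1 : \det g1 = 1) (d2 : \det g2 = 1) (sch : schottky g1 g2).
Let Gamma := Gamma_of (g1, g2).

Lemma det1_GL2Z (g : M2Z) : \det g = 1 -> GL2Z g.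
Proof. by move=> d; rewrite /GL2Z /= unitmxE d unitr1. Qed.

Lemma is_subgroup_words : is_subgroup [set x | exists w, x = weval g1 g2 w].
Proof.
split; first by move=> _ [w ->]; apply: det1_GL2Z; exact: det_weval.
split; first by exists [::].
split; first by move=> _ _ [w ->] [w' ->]; exists (w ++ w'); rewrite weval_cat.
move=> _ [w ->]; exists (rev (map linv w)).
have u := det1_GL2Z (det_weval d1 d2 w).
by rewrite -[LHS]mul1mx -(weval_rev d1 d2 w) mulmxK.
Qed.

Lemma Gamma_of_weval x : Gamma x -> exists w, x = weval g1 g2 w.
Proof.
move=> /(_ _ is_subgroup_words); apply => y [[[|]|]|] /= ->.
- by exists [:: (true, true)]; rewrite /= mulmx1.
- by exists [:: (true, false)]; rewrite /= mulmx1 invmx_adj22.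
- by exists [:: (false, true)]; rewrite /= mulmx1.
- by exists [:: (false, false)]; rewrite /= mulmx1 invmx_adj22.
Qed.

Lemma Gamma_ofM x y : Gamma x -> Gamma y -> Gamma (x *m y).
Proof. by move=> hx hy H hH sH; have [_ [_ [hM _]]] := hH; apply: hM;
  [exact: hx|exact: hy]. Qed.

Lemma Gamma_ofV x : Gamma x -> Gamma (invmx x).
Proof. by move=> hx H hH sH; have [_ [_ [_ hV]]] := hH; apply: hV; exact: hx. Qed.

Lemma Gamma_of1 : Gamma 1%:M.
Proof. by move=> H [_ [h1 _]] _. Qed.

Lemma Gamma_ofX x n : Gamma x -> Gamma (x ^+ n).
Proof.
by move=> hx; elim: n => [|n IH]; [exact: Gamma_of1 | rewrite exprS; exact: Gamma_ofM].
Qed.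

Lemma Gamma_ofl : Gamma g1.
Proof. by move=> H _; apply; left; left; left. Qed.

Lemma Gamma_ofr : Gamma g2.
Proof. by move=> H _; apply; left; right. Qed.

(** In the eigenbasis [W] the matrix [g1] is diagonal, while [g2] and the translation have no zero
    entry, so [meval_double_torus] applies to words in [Gamma]. *)
Lemma unipotent_zariski (k : int) : `|g1 0 0 + g1 1 1| + 2 <= k ->
  zariski_closure_GL2Z R Gamma (mx22 1 k 0 1).
Proof.
move=> hk; have du : \det (mx22 1 k 0 1) = 1 by rewrite det_mx22 !mx22E; ring.
split; first exact: det1_GL2Z.
move=> p vanish.
pose f : {rmorphism R -> complex R} := real_complex R.
have entE g : @entries R g = mx_entries (map_mx f (intmx R g)).
  by apply/funext => i; rewrite /entries /mx_entries !mxE rmorph_int.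
(* Disjointness of the intervals of [g1] and its inverse reads [2 |c| < |a + d| |c|]. *)
have t2 : 2 < `|(g1 0 0 + g1 1 1)%:~R| :> R.
  rewrite -intr_norm -[2]/(2%:~R) ltr_int.
  have := @schottky_apart _ _ sch (true, true) (true, false) isT.
  rewrite /letter /= /apart !mx22E.
  have -> : g1 0 0 * - g1 1 0 - g1 1 1 * g1 1 0 = - ((g1 0 0 + g1 1 1) * g1 1 0) by ring.
  rewrite !normrN normrM; move: (normr_ge0 (g1 1 0)); move: `|g1 1 0| `|g1 0 0 + g1 1 1| => C T.
  by nia.
have [l [l1 tr]] := hyperbolic_eigenvalue t2.
have l0 : l != 0 by rewrite -normr_gt0; exact: lt_trans ltr01 l1.
pose W := eigenmx g1 l; have uW : W \in unitmx by exact: (eigenmx_unit d1 d2 sch l1).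
have uW' : map_mx f W \in unitmx by rewrite map_unitmx.
pose m := invmx W *m intmx R g2 *m W.
have nzf (h : 'M[R]_2) : nz_entries h -> nz_entries (map_mx f h).
  by move=> nz i j; rewrite mxE fmorph_eq0.
have dconj g : \det g = 1 -> \det (invmx W *m intmx R g *m W) = 1.
  move=> dg; rewrite !det_mulmx det_inv mulrAC mulVf ?mul1r; last by rewrite -unitfE -unitmxE.
  by rewrite det_map_mx dg.
have conjK (h : 'M[R]_2) : map_mx f h = map_mx f W *m map_mx f (invmx W *m h *m W) *m
  invmx (map_mx f W).
  by rewrite -map_invmx -!map_mxM !mulmxA mulmxV // mul1mx -mulmxA mulmxV // mulmx1.
rewrite entE conjK.
apply: (@meval_double_torus _ p (f l) (map_mx f m)) => //.
- by rewrite fmorph_eq0.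
- move=> i j; rewrite -!rmorphXn => /fmorph_inj /(congr1 Num.norm); rewrite !normrX.
  by apply: ieexprIn; [exact: lt_trans ltr01 l1 | rewrite gt_eqF].
- by rewrite det_map_mx dconj // rmorph1.
- by rewrite det_map_mx dconj // rmorph1.
- by apply: nzf; exact: (schottky_nz_conj d1 d2 sch l1 tr).
- by apply: nzf; exact: (unipotent_nz_conj d1 d2 sch l1 tr hk).
move=> i n j.
have diagE e : diag22 (f l ^+ e) = map_mx f (invmx W *m (intmx R g1 ^+ e) *m W).
  have -> : diag22 (f l ^+ e) = map_mx f (diag22 (l ^+ e)).
    by apply: eq_mx22; rewrite !mxE /= ?rmorph0 ?fmorphV ?rmorphXn.
  congr map_mx; rewrite -diag22_exp.
  elim: e => [|e IH]; first by rewrite !expr0 mulmx1 mulVmx.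
  rewrite !exprS IH -!mulmxE !mulmxA; congr (_ *m _ *m _).
  by rewrite -[RHS](mulmxK uW) -(mulmxA _ (intmx R g1) W) (intmx_eigen d1 l1 tr) mulKmx.
have -> : map_mx f W *m (diag22 (f l ^+ i) *m map_mx f m *m diag22 (f l ^+ n) *m
     map_mx f m *m diag22 (f l ^+ j)) *m invmx (map_mx f W) =
   map_mx f (intmx R (g1 ^+ i *m g2 *m g1 ^+ n *m g2 *m g1 ^+ j)).
  rewrite !diagE -!map_mxM [RHS]conjK -!map_mxM; congr (map_mx f _ *m _); congr (_ *m _).
  rewrite /intmx !map_mxM !rmorphXn /m !mulmxA.
  by rewrite !(mulmxKV uW, mulmxK uW).
rewrite -entE; apply: vanish.
by do !apply: Gamma_ofM; do ?apply: Gamma_ofX; solve [exact: Gamma_ofl | exact: Gamma_ofr].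
Qed.

(** With finitely many cosets, two of the translations [h i] would share one, and their quotient
    would be a nontrivial translation in [Gamma]. *)
Lemma schottky_thin : thin R Gamma.
Proof.
move=> [s [_ hs]].
pose K := `|g1 0 0 + g1 1 1| + 2.
pose h (i : nat) : M2Z := mx22 1 (K + i%:Z) 0 1.
have hZ i : exists x, x \in s /\ Gamma (invmx x *m h i).
  have /hs [x xs xg] : zariski_closure_GL2Z R Gamma (h i) by apply: unipotent_zariski;
    rewrite /K; lia.
  by exists x.
have [F hF] := choice hZ.
pose L := [seq F i | i <- iota 0 (size s).+1].
have /uniqPn : ~~ uniq L.
  apply/negP => uL; have := @uniq_leq_size _ L s uL.
  rewrite size_map size_iota ltnn => H; suff : false by [].
  by apply: H => _ /mapP[i _ ->]; case: (hF i).
move=> /(_ 1%:M) [i [j [ij jL]]].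
rewrite size_map size_iota in jL.
rewrite !(nth_map 0%N) ?size_iota ?(ltn_trans ij) // !nth_iota ?(ltn_trans ij) // !add0n => FE.
have [_ hi] := hF i; have [_ hj] := hF j; rewrite -FE in hj.
have det_h n : \det (h n) = 1 by rewrite det_mx22 !mx22E; ring.
(* The representative is invertible because [invmx (F i) *m h i] is a word, so its determinant is
   one, like that of [h i]. *)
have GLx : F i \in unitmx.
  have [w e] := Gamma_of_weval hi.
  have : \det (invmx (F i) *m h i) = 1 by rewrite e det_weval.
  rewrite det_mulmx det_h mulr1 det_inv => e1.
  by rewrite unitmxE -unitrV e1 unitr1.
have : Gamma (mx22 1 (j%:Z - i%:Z) 0 1).
  have -> : mx22 1 (j%:Z - i%:Z) 0 1 = invmx (invmx (F i) *m h i) *m (invmx (F i) *m h j).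
    have uh : h i \in unitmx by apply: det1_GL2Z.
    have {1}-> : invmx (invmx (F i) *m h i) = invmx (h i) *m F i.
      rewrite -[in RHS](invmxK (F i)); apply: (@invrM 'M[int]_2) => //.
      by change (invmx (F i) \in unitmx); rewrite unitmx_inv.
    rewrite -mulmxA mulKVmx // invmx_adj22 // /adj22 mulmx22; apply: eq_mx22; rewrite !mx22E;
      ring.
  by apply: Gamma_ofM => //; exact: Gamma_ofV.
move/Gamma_of_weval => [w e].
have := weval_unipotent d1 d2 sch (esym e); lia.
Qed.

End Thinness.

(** * Counting matrices in a box *)

Definition zrange (N : nat) : seq int := [seq i%:Z - N%:Z | i <- iota 0 (2 * N).+1].

Lemma size_zrange N : size (zrange N) = (2 * N).+1.
Proof. by rewrite size_map size_iota. Qed.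

Lemma mem_zrange N (x : int) : (x \in zrange N) = (`|x| <= N%:Z).
Proof.
apply/mapP/idP => [[i +]|h]; first by rewrite mem_iota => h ->; lia.
by exists (absz (x + N%:Z)%R); [rewrite mem_iota|]; lia.
Qed.

Section Fibers.
Variables (T U : eqType) (f : T -> U).

Lemma size_fiber (s : seq T) (r : seq U) (B : nat) :
  {in s, forall x, f x \in r} ->
  {in r, forall k, (size [seq x <- s | f x == k] <= B)%N} ->
  (size s <= size r * B)%N.
Proof.
move=> sr hB.
have -> : size s = count (fun x => f x \in r) s.
  by apply/esym/eqP; rewrite -all_count; apply/allP.
elim: r hB {sr} => [|k r IH] hB; first by rewrite (eq_count (a2 := pred0)) ?count_pred0.
rewrite mulSn; apply: leq_trans (leq_add (hB k (mem_head _ _)) (IH _)); last first.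
  by move=> k' k'r; apply: hB; rewrite inE k'r orbT.
rewrite size_filter -count_predUI; apply: leq_trans (leq_addr _ _).
by apply: sub_count => x /=; rewrite inE.
Qed.

End Fibers.

Lemma size_eq1 (T : eqType) (s : seq T) :
  uniq s -> {in s &, forall x y, x = y} -> (size s <= 1)%N.
Proof.
case: s => [|x [|y s]] //= /andP[+ _] h.
by rewrite (h y x) ?inE ?eqxx ?orbT.
Qed.

Lemma size_le2 (T : eqType) (s : seq T) : uniq s ->
  (forall x y z, x \in s -> y \in s -> z \in s -> x != y -> y != z -> x != z -> False) ->
  (size s <= 2)%N.
Proof.
case: s => [|x [|y [|z s]]] //= + h.
rewrite !inE !negb_or => /and4P[/and3P[xy xz _] /andP[yz _] _ _].
by case: (h x y z); rewrite ?inE ?eqxx ?orbT.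
Qed.

(** The integers from [-N] to [N] are cut into blocks of length [m], numbered from [0] to
    [(2 * N) %/ m]. *)
Lemma size_blocks (s : seq int) (N m r : nat) : (0 < m)%N ->
  {in s, forall x, `|x| <= N%:Z} ->
  (forall q, size [seq x <- s | absz (x + N%:Z)%R %/ m == q]%N <= r)%N ->
  (size s <= ((2 * N) %/ m).+1 * r)%N.
Proof.
move=> m0 sN h; rewrite -[X in (X * r)%N](size_iota 0).
apply: (size_fiber (f := fun x : int => absz (x + N%:Z)%R %/ m)%N) => [x /sN xN|q _];
  last exact: h.
by rewrite mem_iota /= add0n ltnS leq_div2r //; lia.
Qed.

Lemma block_dist (x y : int) (N m q : nat) : (0 < m)%N ->
  `|x| <= N%:Z -> `|y| <= N%:Z ->
  (absz (x + N%:Z)%R %/ m)%N == q -> (absz (y + N%:Z)%R %/ m)%N == q -> `|x - y| < m%:Z.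
Proof.
move=> m0 xN yN /eqP xq /eqP yq.
have ex := divn_eq (absz (x + N%:Z)%R) m; have ey := divn_eq (absz (y + N%:Z)%R) m.
rewrite xq in ex; rewrite yq in ey.
have := ltn_pmod (absz (x + N%:Z)%R) m0; have := ltn_pmod (absz (y + N%:Z)%R) m0.
move: (q * m)%N (_ %% m)%N (_ %% m)%N ex ey => u v w; lia.
Qed.

Lemma size_separated (s : seq int) (N m : nat) : (0 < m)%N -> uniq s ->
  {in s, forall x, `|x| <= N%:Z} ->
  {in s &, forall x y, x != y -> m%:Z <= `|x - y|} ->
  (size s <= ((2 * N) %/ m).+1)%N.
Proof.
move=> m0 us sN sep; rewrite -[X in (_ <= X)%N]muln1; apply: size_blocks => // q.
apply: size_eq1; first exact: filter_uniq.
move=> x y; rewrite !mem_filter => /andP[xq xs] /andP[yq ys].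
apply/eqP/negPn/negP => /(sep _ _ xs ys); rewrite leNgt.
by rewrite (block_dist m0 (sN _ xs) (sN _ ys) xq yq).
Qed.

Lemma size_spread (s : seq int) (D : nat) : uniq s ->
  {in s &, forall x y, `|x - y| <= D%:Z} -> (size s <= (2 * D).+1)%N.
Proof.
case: s => [//|x0 s] us h; rewrite -(size_zrange D) -(size_map (fun x => x - x0)).
apply: uniq_leq_size; first by rewrite map_inj_uniq // => x y /addIr.
by move=> _ /mapP[x xs ->]; rewrite mem_zrange h // mem_head.
Qed.

Lemma dvd_norm_le (c k x : int) : x = c * k -> x != 0 -> `|c| <= `|x|.
Proof.
move=> ->; rewrite mulf_eq0 negb_or normrM => /andP[_ k0].
by rewrite ler_peMr // -gtz0_ge1 normr_gt0.
Qed.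

Definition in_box (N : nat) (g : 'M[int]_2) : bool :=
  [forall i, forall j, `|g i j| <= N%:Z].

Lemma in_boxP N g i j : in_box N g -> `|g i j| <= N%:Z.
Proof. by move=> /forallP/(_ i)/forallP/(_ j). Qed.

Definition sl2box (N : nat) (s : seq 'M[int]_2) : Prop :=
  uniq s /\ {in s, forall g, \det g = 1 /\ in_box N g}.

Lemma sl2box_filter N s p : sl2box N s -> sl2box N [seq x <- s | p x].
Proof.
move=> [us hs]; split; first exact: filter_uniq.
by move=> g; rewrite mem_filter => /andP[_ /hs].
Qed.

Lemma sl2box_adj22 N s : sl2box N s -> sl2box N [seq adj22 x | x <- s].
Proof.
move=> [us hs]; split; first by rewrite map_inj_uniq //; exact: inv_inj (@adj22K _).
move=> _ /mapP[g /hs[d1 bg] ->]; split; first by rewrite det_adj22.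
apply/forallP => i; apply/forallP => j.
by case: (ord2P i) => ->; case: (ord2P j) => ->; rewrite mx22E ?normrN in_boxP.
Qed.

Lemma det1E (g : 'M[int]_2) : \det g = 1 -> g 0 0 * g 1 1 - g 0 1 * g 1 0 = 1.
Proof. by rewrite det_mx22. Qed.

Section Counting.
Variables (N : nat).
Hypothesis N0 : (0 < N)%N.

(* Two completions of a column [(a, c)] to a matrix of determinant one differ
   by a multiple of that column. *)
Lemma size_completions s (a c : int) (m : nat) : sl2box N s ->
  {in s, forall g : 'M[int]_2, g 0 0 = a /\ g 1 0 = c} ->
  (0 < m)%N -> m%:Z <= `|a| \/ m%:Z <= `|c| ->
  (size s <= ((2 * N) %/ m).+1)%N.
Proof.
move=> [us hs] hac m0 [ma|mc].
- rewrite -(size_map (fun g : 'M[int]_2 => g 0 1)); apply: size_separated => //.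
  + rewrite map_inj_in_uniq // => g h gs hs' e.
    have [/det1E dg _] := hs g gs; have [/det1E dh _] := hs h hs'.
    have [ga gc] := hac g gs; have [ha hc] := hac h hs'.
    have a0 : a != 0 by move: ma; lia.
    apply: eq_mx22; rewrite ?ga ?gc ?ha ?hc //.
    apply: (mulfI a0); rewrite ga gc in dg; rewrite ha hc -e in dh.
    by apply: (addIr (- (g 0 1 * c))); rewrite dg dh.
  + by move=> _ /mapP[g /hs[_ bg] ->]; exact: in_boxP.
  + move=> _ _ /mapP[g gs ->] /mapP[h hs' ->] ne.
    have [/det1E dg _] := hs g gs; have [/det1E dh _] := hs h hs'.
    have [ga gc] := hac g gs; have [ha hc] := hac h hs'.
    rewrite ga gc in dg; rewrite ha hc in dh.
    apply: le_trans ma _; apply: (@dvd_norm_le _ (h 1 1 * g 0 1 - g 1 1 * h 0 1)).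
      have eg : a * g 1 1 = 1 + g 0 1 * c by rewrite -dg; ring.
      have eh : a * h 1 1 = 1 + h 0 1 * c by rewrite -dh; ring.
      by rewrite mulrBr !mulrA eg eh; ring.
    by rewrite subr_eq0.
- rewrite -(size_map (fun g : 'M[int]_2 => g 1 1)); apply: size_separated => //.
  + rewrite map_inj_in_uniq // => g h gs hs' e.
    have [/det1E dg _] := hs g gs; have [/det1E dh _] := hs h hs'.
    have [ga gc] := hac g gs; have [ha hc] := hac h hs'.
    have c0 : c != 0 by move: mc; lia.
    apply: eq_mx22; rewrite ?ga ?gc ?ha ?hc //.
    apply: (mulIf c0); rewrite ga gc in dg; rewrite ha hc -e in dh.
    by apply: oppr_inj; apply: (addrI (a * g 1 1)); rewrite dg dh.
  + by move=> _ /mapP[g /hs[_ bg] ->]; exact: in_boxP.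
  + move=> _ _ /mapP[g gs ->] /mapP[h hs' ->] ne.
    have [/det1E dg _] := hs g gs; have [/det1E dh _] := hs h hs'.
    have [ga gc] := hac g gs; have [ha hc] := hac h hs'.
    rewrite ga gc in dg; rewrite ha hc in dh.
    apply: le_trans mc _; apply: (@dvd_norm_le _ (g 0 1 * h 1 1 - h 0 1 * g 1 1)).
      have eg : g 0 1 * c = a * g 1 1 - 1 by rewrite -dg; ring.
      have eh : h 0 1 * c = a * h 1 1 - 1 by rewrite -dh; ring.
      by rewrite mulrBr !mulrA !(mulrC c) eg eh; ring.
    by rewrite subr_eq0.
Qed.

(** For each [c], there are fewer than [2 L] values of [a] with [|a| < L], each with at most [3 N]
    completions; the other values of [a], at most [3 N] in number, have at most [2 N / L + 1]
    completions each. *)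
Lemma size_small_c s (M L : nat) : sl2box N s -> (0 < L)%N -> (0 < M)%N ->
  {in s, forall g : 'M[int]_2, `|g 1 0| < M%:Z} ->
  (size s <= (2 * M) * ((2 * L) * (3 * N) + (3 * N) * ((2 * N) %/ L).+1))%N.
Proof.
move=> bs L0 M0 hc.
apply: leq_trans (size_fiber (f := fun g : 'M[int]_2 => g 1 0) (r := zrange M.-1)
  (B := (2 * L) * (3 * N) + (3 * N) * ((2 * N) %/ L).+1) _ _) _; last first.
- by rewrite size_zrange leq_mul2r; apply/orP; right; lia.
- move=> c _; set s1 := seq.filter _ _.
  have b1 : sl2box N s1 by exact: sl2box_filter.
  have h1 : {in s1, forall g : 'M[int]_2, g 1 0 = c} by move=> g;
    rewrite mem_filter => /andP[/eqP].
  rewrite -(count_predC (fun g : 'M[int]_2 => `|g 0 0| < L%:Z) s1) -!size_filter.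
  apply: leq_add.
    set s2 := seq.filter _ _; have b2 : sl2box N s2 by exact: sl2box_filter.
    apply: leq_trans (size_fiber (f := fun g : 'M[int]_2 => g 0 0) (r := zrange L.-1)
      (B := 3 * N) _ _) _; last first.
    + by rewrite size_zrange leq_mul2r; apply/orP; right; lia.
    + move=> a _; set s3 := seq.filter _ _; have b3 : sl2box N s3 by exact: sl2box_filter.
      have h3 : {in s3, forall g : 'M[int]_2, g 0 0 = a /\ g 1 0 = c}.
        by move=> g; rewrite !mem_filter => /andP[/eqP -> /andP[_ gs1]];
          rewrite h1 // mem_filter.
      case: (s3) b3 h3 => [//|g s4] b3 h3.
      (* With [m = 1] it is enough that [a] and [c] are not both zero, which determinant one
         ensures. *)
      apply: leq_trans (size_completions (m := 1) b3 h3 isT _) _; last by rewrite divn1; lia.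
      have [/det1E d _] := b3.2 g (mem_head _ _); have [ga gc] := h3 g (mem_head _ _).
      rewrite ga gc in d; have [a0|a0] := eqVneq a 0; last by left; lia.
      by right; have [c0|] := eqVneq c 0; [move: d; rewrite a0 c0; lia | lia].
    + by move=> g; rewrite mem_filter mem_zrange => /andP[]; lia.
  set s2 := seq.filter _ _; have b2 : sl2box N s2 by exact: sl2box_filter.
  apply: leq_trans (size_fiber (f := fun g : 'M[int]_2 => g 0 0) (r := zrange N)
      (B := ((2 * N) %/ L).+1) _ _) _; last first.
  + by rewrite size_zrange leq_mul2r; apply/orP; right; lia.
  + move=> a _; set s3 := seq.filter _ _; have b3 : sl2box N s3 by exact: sl2box_filter.
    have h3 : {in s3, forall g : 'M[int]_2, [/\ L%:Z <= `|a|, g 0 0 = a & g 1 0 = c]}.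
      move=> g; rewrite !mem_filter => /andP[/eqP <- /andP[/= la gs1]]; split=> //.
        by rewrite leNgt.
      by rewrite h1 // mem_filter.
    case: (s3) b3 h3 => [//|g s4] b3 h3.
    apply: (@size_completions _ a c) b3 _ L0 _; last by left; case: (h3 g (mem_head _ _)).
    by move=> ? /h3[].
  + by move=> g /b2.2[_ bg]; rewrite mem_zrange in_boxP.
- by move=> g /hc; rewrite mem_zrange; lia.
Qed.

(** Given the trace [t] and [c], the entry [a] determines the matrix and is a root of
    [X^2 - t X + 1] modulo [c]; a block of length [K] contains at most two of these roots. *)
Lemma size_small_trace s (K : nat) : sl2box N s -> (0 < K)%N ->
  {in s, forall g : 'M[int]_2, (K ^ 3)%:Z <= `|g 1 0| /\ `|g 0 0 + g 1 1| <= 2} ->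
  (size s <= 5 * (3 * N * (((2 * N) %/ K).+1 * 2)))%N.
Proof.
move=> bs K0 hs; rewrite -[X in (X * _)%N](size_zrange 2).
apply: (size_fiber (f := fun g : 'M[int]_2 => g 0 0 + g 1 1)).
  by move=> g /hs[_ h]; rewrite mem_zrange.
move=> t _; set s1 := seq.filter _ _; have b1 : sl2box N s1 by exact: sl2box_filter.
apply: leq_trans (size_fiber (f := fun g : 'M[int]_2 => g 1 0) (r := zrange N)
      (B := ((2 * N) %/ K).+1 * 2) _ _) _; last first.
- by rewrite size_zrange leq_mul2r; apply/orP; right; lia.
- move=> c _; set s2 := seq.filter _ _; have b2 : sl2box N s2 by exact: sl2box_filter.
  have h2 : {in s2, forall g : 'M[int]_2,
    [/\ (K ^ 3)%:Z <= `|c|, g 1 1 = t - g 0 0, g 1 0 = c & g 0 1 * c =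
      g 0 0 * (t - g 0 0) - 1]}.
    move=> g; rewrite !mem_filter => /andP[/eqP <- /andP[/eqP <- gs]].
    have [kc _] := hs g gs; have [/det1E d _] := bs.2 g gs; split=> //; first by ring.
    by rewrite -d; ring.
  rewrite -(size_map (fun g : 'M[int]_2 => g 0 0)); apply: size_blocks => //.
    by move=> _ /mapP[g /b2.2[_ bg] ->]; exact: in_boxP.
  move=> q; apply: size_le2.
    apply: filter_uniq; rewrite map_inj_in_uniq ?b2.1 // =>
      g h /h2[kc gd gc gb] /h2[_ hd hc hb] e.
    apply: eq_mx22; rewrite ?gd ?gc ?hd ?hc ?e //.
    have c0 : c != 0 by rewrite -normr_gt0; apply: lt_le_trans kc; rewrite ltz_nat expn_gt0 K0.
    by apply: (mulIf c0); rewrite gb hb e.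
  move=> x y z; rewrite !mem_filter => /andP[xq /mapP[g gs ex]] /andP[yq /mapP[h hs' ey]].
  move=> /andP[zq /mapP[k ks ez]] xy yz xz.
  have [kc _ _ gb] := h2 g gs; have [_ _ _ hb] := h2 h hs'; have [_ _ _ kb] := h2 k ks.
  have inb u us := in_boxP 0 0 (b2.2 u us).2.
  have := (inb g gs, inb h hs', inb k ks); rewrite -ex -ey -ez => -[[xN yN] zN].
  rewrite -ex -ey -ez in gb hb kb.
  have dxy := block_dist K0 xN yN xq yq; have dyz := block_dist K0 yN zN yq zq.
  have dxz := block_dist K0 xN zN xq zq.
  have nz : (x - y) * (y - z) * (x - z) != 0 by rewrite !mulf_neq0 ?subr_eq0.
  (* [- g 0 1 * c] is a monic quadratic polynomial in [g 0 0], so its second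
     divided difference at [x], [y], [z] is one. *)
  have dvd : (x - y) * (y - z) * (x - z) =
      c * ((x - y) * (g 0 1 - k 0 1) - (x - z) * (g 0 1 - h 0 1)).
    transitivity ((x - y) * (g 0 1 * c - k 0 1 * c) - (x - z) * (g 0 1 * c - h 0 1 * c));
      last by ring.
    by rewrite gb hb kb; ring.
  have := dvd_norm_le dvd nz; apply/negP; rewrite -ltNge !normrM.
  apply: lt_le_trans kc; rewrite -[(K ^ 3)%N]/(K * (K * K))%N !PoszM mulrA.
  by apply: ltr_pM => //; rewrite ?mulr_ge0 //; apply: ltr_pM.
- by move=> g /b1.2[_ bg]; rewrite mem_zrange in_boxP.
Qed.

(** Given [c], closeness leaves [O(|c| / M)] values of [a], each with at most [2 N / |c| + 1]
    completions. This makes [O(N / M)] matrices for each of the [O(N)] values of [c]. *)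
Lemma size_near s (M : nat) (a0 c0 : int) : sl2box N s -> (0 < M)%N -> M%:Z <= `|c0| ->
  {in s, forall g : 'M[int]_2, M%:Z <= `|g 1 0| /\ ~~ apart (g 0 0) (g 1 0) a0 c0} ->
  (M * size s <= 81 * N ^ 2)%N.
Proof.
move=> bs M0 mc0 hs.
have key : (size s <= 3 * N * ((27 * N) %/ M))%N.
  apply: leq_trans (size_fiber (f := fun g : 'M[int]_2 => g 1 0) (r := zrange N)
      (B := (27 * N) %/ M) _ _) _; last first.
  - by rewrite size_zrange leq_mul2r; apply/orP; right; lia.
  - move=> c _; set s1 := seq.filter _ _; have b1 : sl2box N s1 by exact: sl2box_filter.
    have h1 : {in s1, forall g : 'M[int]_2,
      [/\ M%:Z <= `|c|, `|g 0 0 * c0 - a0 * c| <= `|c| + `|c0|, `|c| <= N%:Z & g 1 0 = c]}.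
      move=> g; rewrite mem_filter => /andP[/eqP <- gs].
      have [mc] := hs g gs; rewrite /apart -leNgt => near; split=> //.
      by rewrite in_boxP //; exact: (bs.2 g gs).2.
    rewrite leq_divRL //.
    have [-> //|s10] := eqVneq s1 [::].
    have [g0 g0s] : exists g0, g0 \in s1 by case: (s1) s10 => [//|g0 ? _]; exists g0;
      exact: mem_head.
    have [mc _ cN _] := h1 g0 g0s.
    pose r := undup [seq g 0 0 | g : 'M[int]_2 <- s1].
    (* Two such values of [a] differ by at most [2 |c| / |c0| + 2], and [M <= |c0|]. *)
    pose D := ((2 * absz c) %/ M + 2)%N.
    have szr : (size r <= (2 * D).+1)%N.
      apply: size_spread; first exact: undup_uniq.
      move=> x y; rewrite !mem_undup => /mapP[g gs ->] /mapP[h hs' ->].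
      have [_ ng _ _] := h1 g gs; have [_ nh _ _] := h1 h hs'.
      have : `|g 0 0 - h 0 0| * `|c0| <= (`|c| + `|c0|) + (`|c| + `|c0|).
        rewrite -normrM (_ : _ * _ = (g 0 0 * c0 - a0 * c) - (h 0 0 * c0 - a0 * c));
          last by ring.
        by apply: le_trans (ler_normB _ _) _; exact: lerD.
      rewrite /D; move: `|g 0 0 - h 0 0| (normr_ge0 (g 0 0 - h 0 0)) => e e0 le.
      have := divn_eq (2 * absz c) M; have := ltn_pmod (2 * absz c) M0.
      move: ((2 * absz c) %/ M)%N (_ %% M)%N => q r' rM qe.
      rewrite leNgt; apply/negP => lt.
      have : ((q + 2) %:Z + 1) * `|c0| <= e * `|c0| by rewrite ler_pM2r //; lia.
      have : (q%:Z + 1) * M%:Z <= (q%:Z + 1) * `|c0| by rewrite ler_pM2l //; lia.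
      by nia.
    have sz : (size s1 <= size r * ((2 * N) %/ absz c).+1)%N.
      apply: (size_fiber (f := fun g : 'M[int]_2 => g 0 0)).
        by move=> g gs; rewrite mem_undup; exact: map_f.
      move=> a _; apply: (@size_completions _ a c); [exact: sl2box_filter | | lia | right; lia].
      by move=> g; rewrite mem_filter => /andP[/eqP ? /h1[]].
    apply: leq_trans (leq_mul sz (leqnn M)) _.
    apply: leq_trans (leq_mul (leq_mul szr (leqnn _)) (leqnn M)) _; rewrite /D.
    have := leq_trunc_div (2 * absz c) M; have := leq_trunc_div (2 * N) (absz c).
    move: mc cN; move: ((2 * absz c) %/ M)%N ((2 * N) %/ absz c)%N => q p mc cN hp hq.
    (* Here [(2 * D + 1) * M <= 4 |c| + 5 M <= 9 |c|], and then [9 (2 N + |c|) <= 27 N]. *)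
    apply: (@leq_trans (9 * absz c * p.+1)); first by rewrite mulnAC leq_mul2r; apply/orP;
      right; lia.
    by lia.
  - by move=> g /bs.2[_ bg]; rewrite mem_zrange in_boxP.
apply: leq_trans (leq_mul (leqnn M) key) _.
have := leq_trunc_div (27 * N) M.
by rewrite -mulnn mulnCA => h; rewrite (mulnC M); nia.
Qed.

End Counting.

(** * Counting pairs that are not Schottky *)

Lemma apartC (a c a' c' : int) : apart a c a' c' = apart a' c' a c.
Proof. by rewrite /apart addrC distrC. Qed.

(** The centres [a / c] and [- d / c] are at distance [|a + d| / |c|], and the radii add up to
    [2 / |c|]. *)
Lemma apart_inverse (g : 'M[int]_2) : g 1 0 != 0 -> 2 < `|g 0 0 + g 1 1| ->
  apart (g 0 0) (g 1 0) (g 1 1) (- g 1 0).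
Proof.
move=> c0 t2; rewrite /apart normrN.
rewrite (_ : _ - _ = - ((g 0 0 + g 1 1) * g 1 0)); last by ring.
by rewrite normrN normrM -mulr2n -mulr_natl ltr_pM2r ?normr_gt0.
Qed.

Section BadPairs.
Variable M : nat.
Hypothesis M0 : (0 < M)%N.
Implicit Types g h x y : 'M[int]_2.

Definition small_c g := `|g 1 0| < M%:Z.
Definition small_trace g := (M%:Z <= `|g 1 0|) && (`|g 0 0 + g 1 1| <= 2).
Definition near h g := (M%:Z <= `|g 1 0|) && ~~ apart (g 0 0) (g 1 0) (h 0 0) (h 1 0).

(** Of the six pairs among [x], [y] and their inverses, [apart_inverse] settles the two formed by a
    matrix and its own inverse; the other four give the [near] alternatives. *)
Lemma not_schottky x y : ~~ schottky x y ->
  [|| small_c x, small_trace x, small_c y, small_trace y |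
     (M%:Z <= `|y 1 0|) && [|| near y x, near (adj22 y) x, near y (adj22 x) |
                              near (adj22 y) (adj22 x)]].
Proof.
apply: contraNT.
rewrite !negb_or /small_c /small_trace -!leNgt => /and5P[cx + cy].
rewrite cx cy /= -!ltNge => tx ty.
rewrite !negb_or /near !mx22E !normrN cx /= !negbK => /and4P[h1 h2 h3 h4].
have cx0 : x 1 0 != 0 by rewrite -normr_gt0; apply: lt_le_trans cx.
have cy0 : y 1 0 != 0 by rewrite -normr_gt0; apply: lt_le_trans cy.
have ax := apart_inverse cx0 tx; have ay := apart_inverse cy0 ty.
apply/forallP => -[[] []]; apply/forallP => -[[] []]; apply/implyP => //= _;
  by rewrite /letter /= ?mx22E // apartC.
Qed.

Variables (N : nat) (s : seq 'M[int]_2).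
Hypotheses (N0 : (0 < N)%N) (bs : sl2box N s).

Lemma count_near h : M%:Z <= `|h 1 0| -> (M * count (near h) s <= 81 * N ^ 2)%N.
Proof.
move=> mh; rewrite -size_filter; apply: (size_near (a0 := h 0 0) N0 _ M0 mh);
  first exact: sl2box_filter.
by move=> g; rewrite mem_filter => /andP[/andP[? ?] _]; split.
Qed.

Lemma count_near_adj22 h : M%:Z <= `|h 1 0| ->
  (M * count (fun g => near h (adj22 g)) s <= 81 * N ^ 2)%N.
Proof.
move=> mh; have -> : count (fun g => near h (adj22 g)) s = count (near h) (map (@adj22 _) s).
  by rewrite count_map; apply: eq_count.
rewrite -size_filter; apply: (size_near (a0 := h 0 0) N0 _ M0 mh).
  by apply: sl2box_filter; exact: sl2box_adj22.
by move=> g; rewrite mem_filter => /andP[/andP[? ?] _]; split.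
Qed.

End BadPairs.

Lemma count_not_schottky (N K : nat) (s : seq 'M[int]_2) : sl2box N s ->
  (0 < K)%N -> (K ^ 8 <= N)%N ->
  (K * \sum_(y <- s) count (fun x => ~~ schottky x y) s <= 564 * N ^ 2 * size s)%N.
Proof.
move=> bs K0 KN; have N0 : (0 < N)%N by apply: leq_trans KN; rewrite expn_gt0 K0.
have M0 : (0 < K ^ 3)%N by rewrite expn_gt0 K0.
have KM : (K <= K ^ 3)%N by rewrite -{1}(expn1 K) leq_pexp2l.
have hc : (K * count (small_c (K ^ 3)) s <= 30 * N ^ 2)%N.
  rewrite -size_filter.
  (* With [M = K ^ 3] and [L = K ^ 4], the terms [M L N] and [M N ^ 2 / L] of [size_small_c] are
     both [O(N ^ 2 / K)], the first because [K ^ 8 <= N]. *)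
  have L0 : (0 < K ^ 4)%N by rewrite expn_gt0 K0.
  apply: leq_trans (leq_mul (leqnn K) (size_small_c (N := N) N0 _ L0 M0 _)) _.
  - exact: sl2box_filter.
  - by move=> g; rewrite mem_filter => /andP[].
  have h := leq_trunc_div (2 * N) (K ^ 4).
  have e8 : (K ^ 8 = K ^ 4 * K ^ 4)%N by rewrite -expnD.
  have e4 : (K ^ 4 = K * K ^ 3)%N by rewrite -expnS.
  have LN : (K ^ 4 <= N)%N by apply: leq_trans KN; rewrite leq_pexp2l.
  rewrite e8 in KN; rewrite mulnDr mulnDr.
  move: h e4 KN LN L0; move: ((2 * N) %/ K ^ 4)%N => q;
    move: (K ^ 3)%N (K ^ 4)%N => M L h e4 KN LN L0.
  have -> : (K * (2 * M * (2 * L * (3 * N))) = 12 * (L * L) * N)%N by rewrite e4; ring.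
  have -> : (K * (2 * M * (3 * N * q.+1)) = 6 * N * (q * L + L))%N by rewrite e4 -addn1; ring.
  rewrite -mulnn; move: (L * L)%N (q * L)%N KN h => L2 qL; nia.
have ht : (K * count (small_trace (K ^ 3)) s <= 90 * N ^ 2)%N.
  rewrite -size_filter.
  apply: leq_trans (leq_mul (leqnn K) (size_small_trace (N := N) N0 _ K0 _)) _.
  - exact: sl2box_filter.
  - by move=> g; rewrite mem_filter => /andP[/andP[]].
  have h := leq_trunc_div (2 * N) K.
  have LN : (K <= N)%N by apply: leq_trans KN; rewrite -{1}(expn1 K) leq_pexp2l.
  move: h LN; move: ((2 * N) %/ K)%N => q h LN.
  have -> : (K * (5 * (3 * N * (q.+1 * 2))) = 30 * N * (q * K + K))%N by rewrite -addn1; ring.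
  rewrite -mulnn; move: (q * K)%N h => qK; nia.
pose bad (g : 'M[int]_2) := small_c (K ^ 3) g || small_trace (K ^ 3) g.
have hb : (K * count bad s <= 120 * N ^ 2)%N.
  apply: leq_trans (_ : K * (count (small_c (K ^ 3)) s + count (small_trace (K ^ 3)) s) <= _)%N.
    by rewrite leq_mul2l -count_predUI leq_addr orbT.
  by rewrite mulnDr; lia.
(* A bad [y] is allowed to spoil its whole column. For any other [y], either [x] is bad or one of
   four [near] conditions holds, whence [324 = 4 * 81]. *)
have col y : (K * count (fun x => ~~ schottky x y) s <=
    bad y * (K * size s) + (120 * N ^ 2 + 324 * N ^ 2))%N.
  case by_ : (bad y).
    rewrite mul1n; apply: leq_trans (leq_addr _ _).
    by rewrite leq_mul2l count_size orbT.
  rewrite mul0n add0n.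
  have my : (K ^ 3)%:Z <= `|y 1 0| by move: by_; rewrite /bad /small_c; case: ltP.
  have my' : (K ^ 3)%:Z <= `|(adj22 y) 1 0| by rewrite mx22E normrN.
  pose p1 := near (K ^ 3) y; pose p2 := near (K ^ 3) (adj22 y).
  pose p3 g := near (K ^ 3) y (adj22 g); pose p4 g := near (K ^ 3) (adj22 y) (adj22 g).
  have H : (count (fun x => ~~ schottky x y) s <=
     count bad s + (count p1 s + (count p2 s + (count p3 s + count p4 s))))%N.
    apply: leq_trans (_ : count (predU bad (predU p1 (predU p2 (predU p3 p4)))) s <= _)%N.
      apply: sub_count => x /(not_schottky M0) /=; move/negbT: by_; rewrite /bad !negb_or.
      by case/andP => /negPf -> /negPf ->; rewrite my /= orbA.
    have cU (p q : pred 'M[int]_2) : (count (predU p q) s <= count p s + count q s)%N.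
      by rewrite -count_predUI leq_addr.
    by do 3 (apply: leq_trans (cU _ _) _; apply: leq_add => //).
  have n1 : (K * count p1 s <= 81 * N ^ 2)%N.
    by apply: leq_trans (count_near M0 N0 bs my); rewrite leq_mul2r KM orbT.
  have n2 : (K * count p2 s <= 81 * N ^ 2)%N.
    by apply: leq_trans (count_near M0 N0 bs my'); rewrite leq_mul2r KM orbT.
  have n3 : (K * count p3 s <= 81 * N ^ 2)%N.
    by apply: leq_trans (count_near_adj22 M0 N0 bs my); rewrite leq_mul2r KM orbT.
  have n4 : (K * count p4 s <= 81 * N ^ 2)%N.
    by apply: leq_trans (count_near_adj22 M0 N0 bs my'); rewrite leq_mul2r KM orbT.
  apply: leq_trans (leq_mul (leqnn K) H) _; rewrite !mulnDr; lia.
rewrite big_distrr /=.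
apply: (@leq_trans (\sum_(y <- s) (bad y * (K * size s) + (120 * N ^ 2 + 324 * N ^ 2)))).
  by apply: leq_sum => y _; exact: col.
have -> : (\sum_(y <- s) (bad y * (K * size s) + (120 * N ^ 2 + 324 * N ^ 2)) =
    K * count bad s * size s + size s * (120 * N ^ 2 + 324 * N ^ 2))%N.
  rewrite big_split /= -big_distrl /= big_const_seq count_predT iter_addn addn0.
  have -> : (\sum_(y <- s) bad y = count bad s)%N.
    by rewrite -sum1_count [RHS]big_mkcond; apply: eq_bigr => y _; case: (bad y).
  by rewrite mulnCA mulnA (mulnC (size s)).
move: hb; move: (count bad s) (size s) (N ^ 2)%N => b n N2 hb.
by have := leq_mul hb (leqnn n); lia.
Qed.

(** * A lower bound for the number of matrices in a box *)

Lemma telescope_sqr (F : realFieldType) (x : F) : 0 < x ->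
  3 / 4 - x^-1 + (x + 1) ^- 2 <= 3 / 4 - (x + 1)^-1.
Proof.
move=> x0; rewrite -subr_ge0.
rewrite (_ : _ - _ = (x * (x + 1) ^+ 2)^-1); last by field; rewrite !gt_eqF //; lra.
by rewrite invr_ge0 mulr_ge0 ?sqr_ge0 // ltW.
Qed.

(** The term [1 / m] lets the induction close: at [m = 2] the bracket is [1 / 4], and
    [telescope_sqr] gives the step. *)
Lemma sum_sqr_div_lt (F : realFieldType) (n m : nat) : (2 <= m)%N ->
  \sum_(2 <= k < m.+1) (n %/ k)%:R ^+ 2 <= n%:R ^+ 2 * (3 / 4 - m%:R^-1) :> F.
Proof.
have divle k : (0 < k)%N -> (n %/ k)%:R ^+ 2 <= n%:R ^+ 2 * k%:R ^- 2 :> F.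
  move=> k0; rewrite -expr_div_n ler_sqr ?nnegrE ?divr_ge0 //.
  by rewrite ler_pdivlMr ?ltr0n // -natrM ler_nat leq_trunc_div.
elim: m => [//|m IH]; rewrite leq_eqVlt => /predU1P[[<-]|m2].
  rewrite big_nat1; apply: le_trans (divle 2 isT) _; apply: ler_wpM2l; first exact: sqr_ge0.
  by rewrite -exprVn; lra.
rewrite big_nat_recr; last by lia.
apply: le_trans (lerD (IH m2) (divle m.+1 isT)) _.
rewrite -mulrDr; apply: ler_wpM2l; first exact: sqr_ge0.
by rewrite -[m.+1%:R]natr1; apply: telescope_sqr; rewrite ltr0n; lia.
Qed.

Lemma sum_sqr_div (n : nat) : (4 * \sum_(2 <= k < n.+1) (n %/ k) ^ 2 <= 3 * n ^ 2)%N.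
Proof.
case: (leqP 2 n) => [n2|]; last by move=> n1; rewrite big_geq.
have key := sum_sqr_div_lt rat n n2.
have e : (\sum_(2 <= k < n.+1) (n %/ k) ^ 2)%:R = \sum_(2 <= k < n.+1) (n %/ k)%:R ^+ 2 :> rat.
  by rewrite natr_sum; apply: eq_bigr => k _; rewrite natrX.
rewrite -(ler_nat rat) (natrM rat 4) (natrM rat 3) natrX e.
have v0 : 0 <= n%:R^-1 :> rat by rewrite invr_ge0.
have u0 : 0 <= n%:R ^+ 2 :> rat by rewrite sqr_ge0.
move: (\sum_(_ <= _ < _) _) (n%:R^-1) (n%:R ^+ 2) key u0 v0 => s v u key u0 v0.
have := mulr_ge0 u0 v0; rewrite mulrBr in key; lra.
Qed.

(** A pair that is not coprime has a common divisor [k >= 2], and [(n %/ k) ^ 2] pairs have both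
    entries divisible by [k]; by [sum_sqr_div] these make up at most three quarters of the
    square. *)
Lemma coprime_density (n : nat) :
  (n ^ 2 <= 4 * \sum_(1 <= a < n.+1) \sum_(1 <= c < n.+1) coprime a c)%N.
Proof.
have H : (n ^ 2 <= \sum_(1 <= a < n.+1) \sum_(1 <= c < n.+1) coprime a c +
    \sum_(2 <= k < n.+1) (n %/ k) ^ 2)%N.
  have -> : (n ^ 2 = \sum_(1 <= a < n.+1) \sum_(1 <= c < n.+1) 1)%N.
    by rewrite !sum_nat_const_nat !subn1 /= muln1 mulnn.
  have -> : (\sum_(2 <= k < n.+1) (n %/ k) ^ 2 =
      \sum_(1 <= a < n.+1) \sum_(1 <= c < n.+1) \sum_(2 <= k < n.+1) (k %| a) * (k %| c))%N.
    under eq_bigr => k _ do rewrite -mulnn !divn_count_dvd big_distrlr /=.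
    by rewrite exchange_big /=; apply: eq_bigr => a _; rewrite exchange_big.
  rewrite -big_split /= big_nat_cond [X in (_ <= X)%N]big_nat_cond.
  apply: leq_sum => a /andP[/andP[a1 an] _].
  rewrite -big_split /= big_nat_cond [X in (_ <= X)%N]big_nat_cond.
  apply: leq_sum => c /andP[/andP[c1 cn] _].
  have [//|nco] := boolP (coprime a c); rewrite add0n.
  rewrite (bigD1_seq (gcdn a c)) /= ?iota_uniq ?dvdn_gcdl ?dvdn_gcdr //.
  rewrite mem_index_iota; have g0 : (0 < gcdn a c)%N by rewrite gcdn_gt0 a1.
  have := dvdn_leq a1 (dvdn_gcdl a c); move: nco; rewrite /coprime; lia.
have := sum_sqr_div n; lia.
Qed.

(** The Bezout relation of [egcdn] is [e.1 * p.1 = e.2 * p.2 + gcd], already in the form of a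
    determinant. *)
Definition complete_column (p : nat * nat) : 'M[int]_2 :=
  let e := egcdn p.1 p.2 in mx22 p.1%:Z e.2%:Z p.2%:Z e.1%:Z.

Lemma sl2box_large (n : nat) : exists2 s, sl2box n s & (n ^ 2 <= 4 * size s)%N.
Proof.
pose P := [seq (a, c) | a <- iota 1 n, c <- iota 1 n].
pose s := [seq complete_column p | p <- [seq p <- P | coprime p.1 p.2]].
exists s; last first.
  rewrite /s size_map size_filter -sum1_count big_mkcond big_allpairs /=.
  apply: leq_trans (coprime_density n) _; rewrite /index_iota subn1 leq_mul2l.
  by apply: leq_sum => a _; apply: leq_sum => c _; case: coprime.
split.
  rewrite map_inj_uniq; last first.
    move=> [a c] [a' c'] /matrixP e; have := e 0 0; have := e 1 0.
    by rewrite /complete_column !mx22E /= => -[->] [->].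
  by apply: filter_uniq; apply: allpairs_uniq; rewrite ?iota_uniq // => -[? ?] [? ?].
move=> g /mapP[[a c]]; rewrite mem_filter /= => /andP[co /allpairsP[[a' c']]].
rewrite !mem_iota /= => -[an cn [? ?]] ->; subst a' c'.
rewrite /complete_column /=.
have a0 : (0 < a)%N by lia.
have [d b /= + +] := egcdnP c a0; rewrite (eqP co) muln1 => e ba.
(* Since [b < a], one has [d a = b c + 1 <= (a - 1) c + 1 <= a c]; so the completed matrix stays in
   the box. *)
have dc : (d <= c)%N.
  rewrite -(leq_pmul2r a0) e; apply: (@leq_trans (a.-1 * c + 1)); last nia.
  by rewrite leq_add2r leq_mul2r; lia.
split; first by rewrite det_mx22 !mx22E; lia.
apply/forallP => i; apply/forallP => j.
by case: (ord2P i) => ->; case: (ord2P j) => ->; rewrite mx22E; lia.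
Qed.

(** * Norm balls *)

Section OperatorNorm.
Variable R : realType.
Implicit Types g : M2Z.

(** The squared Frobenius norm, that is, the trace of the Gram matrix. *)
Definition frob2 g : R :=
  (g 0 0)%:~R ^+ 2 + (g 0 1)%:~R ^+ 2 + (g 1 0)%:~R ^+ 2 + (g 1 1)%:~R ^+ 2.

Lemma eigenvalue_gram g (a : R) : \det g = 1 ->
  eigenvalue ((intmx R g)^T *m intmx R g) a = (a ^+ 2 - frob2 g * a + 1 == 0).
Proof.
move=> d1; have e : (\det (intmx R g)) ^+ 2 = 1 by rewrite det_map_mx d1 expr1n.
have ce (S : 'M[R]_2) i j : char_poly_mx S i j = 'X *+ (i == j) - (S i j)%:P by rewrite !mxE.
rewrite eigenvalue_root_char /root /char_poly det_mx22 !ce /= !mulmx2E.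
rewrite !(hornerE, hornerD, hornerN, hornerM) /= !mxE.
rewrite det_mx22 !mxE in e; congr (_ == _).
transitivity (a ^+ 2 - frob2 g * a + \det (intmx R g) ^+ 2); rewrite det_mx22 !mxE.
  by rewrite /frob2; ring.
by rewrite e.
Qed.

(** For [g = (a b; c d)], the difference [frob2 g - 2 \det g] is [(a - d)^2 + (b + c)^2]. *)
Lemma frob2_ge2 g : \det g = 1 -> 2 <= frob2 g.
Proof.
rewrite det_mx22 => d1.
have : (g 0 0)%:~R * (g 1 1)%:~R - (g 0 1)%:~R * (g 1 0)%:~R = 1 :> R.
  by rewrite -!intrM -intrB d1.
have := sqr_ge0 ((g 0 0)%:~R - (g 1 1)%:~R : R).
have := sqr_ge0 ((g 0 1)%:~R + (g 1 0)%:~R : R).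
rewrite /frob2; move: (_ %:~R) (_ %:~R) (_ %:~R) (_ %:~R) => a b c d; lra.
Qed.

(** The eigenvalues are the roots of [a ^ 2 - F a + 1]. The larger one is at least half their sum
    [F], and [a (a - F) = -1] excludes roots above [F]. *)
Lemma lambda_max_bounds g : \det g = 1 ->
  frob2 g / 2 <= lambda_max ((intmx R g)^T *m intmx R g) <= frob2 g.
Proof.
move=> d1; have F2 := frob2_ge2 d1; move: (fun a : R => eigenvalue_gram a d1) F2.
move: (frob2 g) (_ *m _) => F S hS F2.
pose r := Num.sqrt (F ^+ 2 - 4); pose l := (F + r) / 2.
have r0 : 0 <= r by rewrite sqrtr_ge0.
have r2 : r ^+ 2 = F ^+ 2 - 4 by rewrite sqr_sqrtr //; nra.
have hl : [set a | eigenvalue S a] l.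
  by rewrite /= hS; apply/eqP; rewrite /l; nra.
have ub : ubound [set a | eigenvalue S a] F.
  move=> a /=; rewrite hS => /eqP e; rewrite leNgt; apply/negP => lt.
  have : 0 < a * (a - F) by apply: mulr_gt0; lra.
  by rewrite mulrBr -expr2 (mulrC a F); lra.
rewrite /lambda_max; apply/andP; split.
  by apply: le_trans (ub_le_sup _ hl); [rewrite /l; lra | exists F].
by apply: ge_sup => //; exists l.
Qed.

Lemma opnorm_le_frob2 g (X : R) : \det g = 1 -> opnorm R g <= X -> 0 <= X /\ frob2 g <=
  2 * X ^+ 2.
Proof.
move=> d1; rewrite /opnorm -/(intmx R g) => h.
have X0 : 0 <= X by apply: le_trans h; rewrite sqrtr_ge0.
split=> //; have /andP[lo _] := lambda_max_bounds d1; have F2 := frob2_ge2 d1.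
move: h lo; set l := lambda_max _ => h lo.
have l0 : 0 <= l by lra.
have : l <= X ^+ 2 by rewrite -(sqr_sqrtr l0) ler_sqr ?nnegrE ?sqrtr_ge0.
lra.
Qed.

Lemma frob2_le_opnorm g (X : R) : \det g = 1 -> 0 <= X -> frob2 g <= X ^+ 2 -> opnorm R g <= X.
Proof.
move=> d1 X0 h; rewrite /opnorm -/(intmx R g).
have /andP[_ hi] := lambda_max_bounds d1.
by rewrite -[leRHS](ger0_norm X0) -sqrtr_sqr ler_wsqrtr // (le_trans hi).
Qed.

End OperatorNorm.

(** * Norm balls compared with boxes, and the proportion of thin pairs *)

Section Ball.
Variables (R : realType) (X : R) (n : nat).
Hypotheses (n0 : (0 < n)%N) (nX : (2 * n)%:R <= X) (Xn : X < (2 * n + 2)%:R).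

(** Each entry is at most the root of [frob2 g <= 2 X ^ 2], hence at most [2 X]. *)
Lemma ball_in_box g : ball_SL2 X g -> \det g = 1 /\ in_box (4 * n + 4) g.
Proof.
move=> [d1 /(opnorm_le_frob2 d1)[X0 hF]]; split=> //.
have X2 : 2 * X <= (4 * n + 4)%:R by rewrite (_ : 4 * n + 4 = 2 * (2 * n + 2))%N ;
  [rewrite natrM ler_pM2l // ltW | lia].
have key (z : int) : z%:~R ^+ 2 <= frob2 R g -> `|z| <= (4 * n + 4)%:Z.
  move=> hz; rewrite -(ler_int R) intr_norm.
  apply: le_trans (_ : 2 * X <= _); last by rewrite -pmulrn.
  rewrite -ler_sqr ?nnegrE ?mulr_ge0 // real_normK ?num_real //.
  by apply: le_trans hz _; apply: le_trans hF _; rewrite exprMn; have := sqr_ge0 X; lra.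
have sq (z : int) : 0 <= z%:~R ^+ 2 :> R by rewrite sqr_ge0.
apply/forallP => i; apply/forallP => j; apply: key; rewrite /frob2.
have := (sq (g 0 0), sq (g 0 1), sq (g 1 0), sq (g 1 1)) => -[[[? ?] ?] ?].
by case: (ord2P i) => ->; case: (ord2P j) => ->; lra.
Qed.

Lemma box_in_ball g : \det g = 1 -> in_box n g -> ball_SL2 X g.
Proof.
move=> d1 bg; split=> //.
have X0 : 0 <= X by apply: le_trans nX.
apply: frob2_le_opnorm => //.
apply: (@le_trans _ _ ((2 * n)%:R ^+ 2)); last by rewrite ler_sqr ?nnegrE.
have sq i j : (g i j)%:~R ^+ 2 <= n%:R ^+ 2 :> R.
  rewrite -[X in X <= _]real_normK ?num_real // ler_sqr ?nnegrE // -intr_norm.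
  by rewrite [X in _ <= X]pmulrn ler_int in_boxP.
have := (sq 0 0, sq 0 1, sq 1 0, sq 1 1) => -[[[? ?] ?] ?].
by rewrite /frob2 natrM exprMn; lra.
Qed.

Lemma finite_ball : finite_set (ball_SL2 X).
Proof.
pose r := zrange (4 * n + 4).
pose L := [seq mx22 p.1.1 p.1.2 p.2.1 p.2.2 | p <- allpairs pair (allpairs pair r r) (allpairs pair r r)].
apply: (@sub_finite_set _ _ [set` L]); last exact: finite_seq.
move=> g /ball_in_box[_ bg] /=; apply/mapP.
exists ((g 0 0, g 0 1), (g 1 0, g 1 1)); last exact: mx22_eta.
by do ?[apply: allpairs_f]; rewrite mem_zrange in_boxP.
Qed.

Let s : seq M2Z := enum_fset (fset_set (ball_SL2 X)).

Lemma mem_ball_seqP g : g \in s <-> ball_SL2 X g.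
Proof.
have e : (g \in s) = (g \in ball_SL2 X) by rewrite /s -in_fset_set //; exact: finite_ball.
by rewrite e; split => [/set_mem|/mem_set].
Qed.

Lemma ball_sl2box : sl2box (4 * n + 4) s.
Proof.
split; first exact: fset_uniq.
by move=> g /mem_ball_seqP /ball_in_box.
Qed.

Lemma ball_card_ge : (n ^ 2 <= 4 * size s)%N.
Proof.
have [s0 [u0 b0] h0] := sl2box_large n.
apply: leq_trans h0 _; rewrite leq_mul2l; apply/orP; right.
by apply: uniq_leq_size => // g /b0[d1 bg]; apply/mem_ball_seqP; exact: box_in_ball.
Qed.

Lemma count_ball2 : count_set (ball_SL2 X `*` ball_SL2 X) = (size s * size s)%N.
Proof.
have fB := finite_ball; rewrite /count_set fset_setX // -(size_allpairs pair).
apply: perm_size; apply: uniq_perm; first exact: fset_uniq.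
  by apply: allpairs_uniq; rewrite ?fset_uniq // => -[? ?] [? ?] _ _ [-> ->].
move=> [x y]; rewrite in_fsetM /=.
by apply/andP/allpairsP => [[xs ys]|[[x' y'] [/= xs ys [-> ->]]]] //; exists (x, y).
Qed.

Lemma count_thin_le : (count_set ((ball_SL2 X `*` ball_SL2 X) `&` @thin_pairs R) <=
  size s * size s)%N.
Proof.
have fB := finite_ball; rewrite -count_ball2 /count_set.
apply: fsubset_leq_card; apply/fsubsetP => p.
by rewrite !in_fset_set ?in_setE; [move=> [] | exact: finite_setX | apply: finite_setIl;
  exact: finite_setX].
Qed.

(** By [schottky_thin], a pair in the ball that is not counted as thin fails [schottky]. The pairs
    are listed with [y] outermost to match the sum. *)
Lemma count_thin_ge :
  (size s * size s <= count_set ((ball_SL2 X `*` ball_SL2 X) `&` @thin_pairs R) +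
    \sum_(y <- s) count (fun x => ~~ schottky x y) s)%N.
Proof.
have fB := finite_ball.
pose P := [seq (x, y) | y <- s, x <- s].
pose L := [seq p <- P | schottky p.1 p.2].
have uP : uniq P.
  by apply: allpairs_uniq; rewrite ?fset_uniq // => -[? ?] [? ?] _ _ [-> ->].
have -> : (size s * size s)%N = size P by rewrite size_allpairs.
rewrite -(count_predC (fun p => schottky p.1 p.2) P) -size_filter -/L.
apply: leq_add.
  apply: uniq_leq_size; first exact: filter_uniq.
  move=> [x y]; rewrite mem_filter => /andP[/= sch /allpairsP[[y' x'] [/= ys xs [? ?]]]];
    subst x' y'.
  have xB := (mem_ball_seqP x).1 xs; have yB := (mem_ball_seqP y).1 ys.
  have th : thin R (Gamma_of (x, y)) := schottky_thin xB.1 yB.1 sch.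
  have -> : ((x, y) \in enum_fset (fset_set (ball_SL2 X `*` ball_SL2 X `&` @thin_pairs R))) =
     ((x, y) \in fset_set (ball_SL2 X `*` ball_SL2 X `&` @thin_pairs R)) by [].
  rewrite in_fset_set; last by apply: finite_setIl; exact: finite_setX.
  exact: (mem_set (conj (conj xB yB) (conj xB.1 (conj yB.1 th)))).
rewrite -sum1_count big_mkcond big_allpairs_dep /=; apply: leq_sum => y _.
by rewrite -sum1_count [X in (_ <= X)%N]big_mkcond.
Qed.

Lemma mu_thin_le1 : mu_X X (@thin_pairs R) <= 1.
Proof.
have s0 : (0 < size s)%N by have := ball_card_ge; rewrite -mulnn; nia.
rewrite /mu_X count_ball2 ler_pdivrMr ?ltr0n ?muln_gt0 ?s0 //.
by rewrite mul1r ler_nat count_thin_le.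
Qed.

Lemma mu_thin_ge (K : nat) : (0 < K)%N -> (K ^ 8 <= 4 * n + 4)%N ->
  1 - (564 * 256)%:R / K%:R <= mu_X X (@thin_pairs R).
Proof.
move=> K0 Kn; have big := ball_card_ge.
have s0 : (0 < size s)%N by move: big; rewrite -mulnn; nia.
have bad := count_not_schottky ball_sl2box K0 Kn.
have ge := count_thin_ge.
rewrite /mu_X count_ball2; move: ge bad; set T := count_set _; set B := (\sum_(y <- s) _)%N.
move: (size s) big s0 => m big s0 ge bad.
(* From [4 n + 4 <= 8 n] and [n ^ 2 <= 4 m], with [256 = 64 * 4]; the bound on bad pairs thus
   becomes a multiple of [m * m]. *)
have n8 : ((4 * n + 4) ^ 2 <= 256 * m)%N.
  apply: (@leq_trans ((8 * n) ^ 2)); first by rewrite leq_sqr; lia.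
  rewrite expnMn; apply: leq_trans (leq_mul (leqnn _) big) _; rewrite mulnA leq_mul2r orbT //.
have KB : (K * B <= 564 * 256 * (m * m))%N.
  by apply: leq_trans bad _; rewrite mulnA; apply: leq_mul; rewrite // -mulnA; exact: leq_mul.
move: KB; move: (564 * 256)%N => C KB.
rewrite ler_pdivlMr ?ltr0n ?muln_gt0 ?s0 // mulrBl mul1r lerBlDr.
apply: (@le_trans _ _ (T + B)%:R); first by rewrite ler_nat.
by rewrite natrD lerD2l mulrAC ler_pdivlMr ?ltr0n // -!natrM ler_nat mulnC.
Qed.

End Ball.

Theorem theorem2p1 (R : realType) :
  mu_X X (@thin_pairs R) @[X --> +oo%R] --> (1 : R).
Proof.
apply/cvgrPdist_le => e e0.
have [K K0 Ke] : exists2 K : nat, (0 < K)%N & (564 * 256)%:R / K%:R <= e.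
  move: (564 * 256)%N => C; exists (Num.truncn (C%:R / e)).+1 => //.
  by rewrite ler_pdivrMr ?ltr0n // mulrC -ler_pdivrMr // ltW // truncnS_gt.
near=> X.
(* This makes the integer part [n] of [X / 2] at least [K ^ 8]. *)
have X2 : (2 * K ^ 8 + 2)%:R <= X by near: X; exact: nbhs_pinfty_ge.
pose n := Num.truncn (X / 2).
have X0 : 0 <= X / 2 by rewrite divr_ge0 // (le_trans _ X2).
have /andP[lo hi] := truncn_itv X0; rewrite -/n in lo hi.
have nX : (2 * n)%:R <= X by rewrite natrM; lra.
have Xn : X < (2 * n + 2)%:R.
  by rewrite natrD natrM; move: hi; rewrite -[n.+1%:R]natr1; lra.
have Kn : (K ^ 8 < n.+1)%N.
  rewrite -(ltr_nat R); apply: le_lt_trans hi.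
  by move: X2; rewrite natrD natrM; lra.
have n0 : (0 < n)%N by apply: leq_trans (_ : K ^ 8 <= n)%N => //; rewrite expn_gt0 K0.
have K8 : (K ^ 8 <= 4 * n + 4)%N by lia.
move: Ke (mu_thin_ge n0 nX Xn K0 K8) (mu_thin_le1 n0 nX Xn).
move: (_ / K%:R) => q qe lo1 hi1.
by rewrite ger0_norm ?subr_ge0 // lerBlDr -lerBlDl (le_trans _ lo1) // lerB.
Unshelve. all: by end_near.
Qed.
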